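(* Fix constants $0<c_0<C_0$. There exist $k_0$ and $K\ge1$ depending only on $c_0,C_0$ such that the following holds for all $k\ge k_0$. Suppose $\alpha=d/k=\mathbf c\,2^{k-1}\ln2$ with $\alpha_{\mathrm{sat}}\le\alpha\le4^k/k$, and suppose $y\ge0$ satisfies $c_0\le\gamma\le C_0$, where $\gamma=2\mathbf c(1-e^{-y/2})^2$. Then in the set $\mathcal M^\bullet$ there is a unique $\dot q_y$ satisfying the fixed-point equation $\dot q_y=\mathrm{SP}_y(\dot q_y)$. Moreover it lies in the smaller domain $\mathcal M^\gamma$, i.e. $$K^{-1}\,\frac{2^{-k\gamma/2}}{(\max\{\mathbf c k e^{-y/2},1\})^{1/2}}\le\dot q_y(\mathsf f)\le K\,\frac{2^{-k\gamma/2}}{(\max\{\mathbf c k e^{-y/2},1\})^{1/2}}.$$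
   Context: $\alpha_{\mathrm{sat}}=\alpha_{\mathrm{sat}}(k)$ is the satisfiability threshold (known to exist for large $k$) of random $d$-regular $k$-NAE-SAT, $\alpha=d/k$: the instance has $N$ variables of degree $d$ and $Nd/k$ clauses of size $k$ joined by a uniformly random matching of half-edges, with i.i.d. uniform edge labels $L_e\in\{0,1\}$; a clause is violated by $\underline x\in\{0,1\}^N$ iff the $k$ values $L_e\oplus x_{v(e)}$ on its edges are all equal. As $N\to\infty$ the probability that some $\underline x$ violates no clause tends to $1$ if $\alpha<\alpha_{\mathrm{sat}}$ and to $0$ if $\alpha>\alpha_{\mathrm{sat}}$; $\alpha_{\mathrm{sat}}=2^{k-1}\ln2-O(1)$. For $m\ge1$ and $b\in\{0,1,\mathsf f\}^m$ let $\ell_0(b),\ell_1(b)$ be the numbers of entries equal to $0$, $1$. Let $\dot W_m(b)=0,1,\mathsf f$ according as $\ell_0(b)>\ell_1(b)$, $\ell_0(b)<\ell_1(b)$, $\ell_0(b)=\ell_1(b)$; let $\hat W_m(b)=0$ if all entries equal $1$, $=1$ if all entries equal $0$, $=\mathsf f$ otherwise; $\dot\varphi_m(b)=\min\{\ell_0(b),\ell_1(b)\}$. $\mathcal M$ is the set of probability measures $q$ on $\{0,1,\mathsf f\}$ with $q(0)=q(1)$, and $\mathcal M^\bullet=\{q\in\mathcal M:q(\mathsf f)\le1/k^2\}$. Define $\widehat{\mathrm{SP}},\dot{\mathrm{SP}}_y:\mathcal M\to\mathcal M$ by $[\widehat{\mathrm{SP}}(q)](h)=\sum_{u\in\{0,1,\mathsf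 f\}^{k-1}}\mathbf 1\{h=\hat W_{k-1}(u)\}\prod_{i=1}^{k-1}q(u_i)$ and $[\dot{\mathrm{SP}}_y(\hat q)](u)=\frac1{\dot z}\sum_{b\in\{0,1,\mathsf f\}^{d-1}}\mathbf 1\{u=\dot W_{d-1}(b)\}e^{-y\dot\varphi_{d-1}(b)}\prod_{i=1}^{d-1}\hat q(b_i)$, with $\dot z$ the normalizing constant; $\mathrm{SP}_y=\dot{\mathrm{SP}}_y\circ\widehat{\mathrm{SP}}$. $\mathcal M^\gamma$ is the set of $q\in\mathcal M^\bullet$ with $q(\mathsf f)\asymp 2^{-k\gamma/2}/(\max\{\mathbf c k e^{-y/2},1\})^{1/2}$, the constants in $\asymp$ not depending on $k,d,y$. *)

(* Defs.v *)
From HB Require Import structures.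
From mathcomp Require Import all_boot all_order all_algebra.
From mathcomp Require Import all_classical all_reals all_analysis.

Set Implicit Arguments.
Unset Strict Implicit.
Unset Printing Implicit Defensive.

Import Order.TTheory GRing.Theory Num.Theory.
Import numFieldNormedType.Exports.

Local Open Scope ring_scope.

(* Random d-regular k-NAE-SAT with N variables and M clauses. The half-edge
   (v, s) is the s-th slot of variable v and (a, j) the j-th slot of clause a.
   An edge is named after its clause half-edge; in [(g, L)], [g] matches clause
   half-edges to variable half-edges and [L] gives the edge labels. *)
Definition nae_data (k d N M : nat) : finType :=
  ({ffun 'I_M * 'I_k -> 'I_N * 'I_d} * {ffun 'I_M * 'I_k -> bool})%type.

(* When M * k = N * d, an injective [g] is a bijection, i.e. a matching. *)
Definition nae_instances (k d N M : nat) : {set nae_data k d N M} :=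
  [set I : nae_data k d N M | injectiveb I.1].

Definition violated (k d N M : nat) (I : nae_data k d N M)
    (x : {ffun 'I_N -> bool}) (a : 'I_M) : bool :=
  [exists v : bool, forall j : 'I_k, I.2 (a, j) (+) x (I.1 (a, j)).1 == v].

Definition satisfiable (k d N M : nat) (I : nae_data k d N M) : bool :=
  [exists x : {ffun 'I_N -> bool}, forall a : 'I_M, ~~ violated I x a].

(* Meaningful when k divides N * d. *)
Definition sat_prob (R : realType) (k d N : nat) : R :=
  let M := (N * d %/ k)%N in
  #|[set I in nae_instances k d N M | satisfiable I]|%:R
    / #|nae_instances k d N M|%:R.

(* N tends to infinity along the values for which N * d / k is an integer.
   Since d is an integer, the condition may hold for an interval of reals
   [asat], of length at most 1 / k. *)
Definition is_sat_threshold (R : realType) (k : nat) (asat : R) : Prop :=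
  forall d : nat,
    (d%:R / k%:R < asat ->
       (sat_prob R k d N @[N --> within [set N | (k %| N * d)%N] \oo] --> (1 : R))%classic)
    /\
    (asat < d%:R / k%:R ->
       (sat_prob R k d N @[N --> within [set N | (k %| N * d)%N] \oo] --> (0 : R))%classic).

(* The alphabet {0, 1, f}. *)
Notation spin := (option bool).
Notation spin0 := (Some false).
Notation spin1 := (Some true).
Notation spinf := (@None bool).

Definition ell (m : nat) (h : spin) (b : {ffun 'I_m -> spin}) : nat :=
  #|[set i | b i == h]|.

Definition dotW (m : nat) (b : {ffun 'I_m -> spin}) : spin :=
  if (ell spin1 b < ell spin0 b)%N then spin0
  else if (ell spin0 b < ell spin1 b)%N then spin1
  else spinf.

(* Only used for m >= 1; the two tests overlap at m = 0. *)
Definition hatW (m : nat) (b : {ffun 'I_m -> spin}) : spin :=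
  if [forall i, b i == spin1] then spin0
  else if [forall i, b i == spin0] then spin1
  else spinf.

Definition dotphi (m : nat) (b : {ffun 'I_m -> spin}) : nat :=
  minn (ell spin0 b) (ell spin1 b).

(* Measures on the alphabet are given by their mass functions. *)
Definition calM (R : realType) : set {ffun spin -> R} :=
  [set q : {ffun spin -> R} |
    [/\ forall h : spin, 0 <= q h, \sum_h q h = 1 & q spin0 = q spin1]]%classic.

Definition calM_bullet (R : realType) (k : nat) : set {ffun spin -> R} :=
  [set q : {ffun spin -> R} | calM q /\ q spinf <= 1 / k%:R ^+ 2]%classic.

Definition hatSP (R : realType) (k : nat) (q : {ffun spin -> R}) :
    {ffun spin -> R} :=
  [ffun h => \sum_(u : {ffun 'I_k.-1 -> spin} | h == hatW u)
               \prod_(i < k.-1) q (u i)].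

Definition dotSP_weight (R : realType) (d : nat) (y : R)
    (qhat : {ffun spin -> R}) (b : {ffun 'I_d.-1 -> spin}) : R :=
  expR (- (y * (dotphi b)%:R)) * \prod_(i < d.-1) qhat (b i).

Definition dotSP (R : realType) (d : nat) (y : R) (qhat : {ffun spin -> R}) :
    {ffun spin -> R} :=
  let z := \sum_(b : {ffun 'I_d.-1 -> spin}) dotSP_weight y qhat b in
  [ffun u => z^-1 * \sum_(b : {ffun 'I_d.-1 -> spin} | u == dotW b)
                      dotSP_weight y qhat b].

Definition SP (R : realType) (k d : nat) (y : R) (q : {ffun spin -> R}) :
    {ffun spin -> R} :=
  dotSP d y (hatSP k q).

Definition gamma (R : realType) (c y : R) : R :=
  2 * c * (1 - expR (- y / 2)) ^+ 2.

Definition qf_scale (R : realType) (k : nat) (c y : R) : R :=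
  2 `^ (- (k%:R * gamma c y / 2))
    / Num.sqrt (Num.max (c * k%:R * expR (- y / 2)) 1).

(* [K] is the constant implicit in the two-sided estimate of [q spinf]. *)
Definition calM_gamma (R : realType) (K : R) (k : nat) (c y : R) :
    set {ffun spin -> R} :=
  [set q : {ffun spin -> R} |
    [/\ calM_bullet k q,
        K^-1 * qf_scale k c y <= q spinf
      & q spinf <= K * qf_scale k c y]]%classic.

(* Main.v *)
Require Import Defs.
From HB Require Import structures.
From mathcomp Require Import all_boot all_order all_algebra.
From mathcomp Require Import all_classical all_reals all_analysis.
From mathcomp Require Import polyrcf ring lra.

Set Implicit Arguments.
Unset Strict Implicit.
Unset Printing Implicit Defensive.

Import Order.TTheory GRing.Theory Num.Theory.
Import numFieldNormedType.Exports.

Local Open Scope ring_scope.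

(** The fixed-point equation has one real unknown. A measure in [calM] is determined
    by [x = q spinf]; a clause sends each of [spin0], [spin1] with probability
    [p = ((1 - x) / 2) ^+ k.-1], and a variable with [n = d.-1] incoming messages
    becomes [spinf] exactly when they tie. So the equation is
    [x = tie_poly s n / total_poly s n] at [p], where [s = expR (- y / 2)]: the
    weight of the ties over the weight of all configurations, a configuration with
    [i] zeros and [j] ones having weight [s ^+ (2 * minn i j)] (lemma [SP_tie]).

    Size of the two weights. Since [s ^+ (2 * minn i j)] lies between
    [s ^+ (2 * i)] and [s ^+ (2 * i) + s ^+ (2 * j)], the total is [D ^+ n] up to a
    factor 2, with [D = 1 - p (1 - s^2)]. A tie is the return to the origin of
    a lazy walk with steps [+1], [-1] of weight [p s] each. Since a lazy step
    is a pair of simple half-steps, the weight of the ties is the average of the central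
    binomial probabilities ['C(2m, m) / 4^m] over a binomial number [m] of pairs
    (lemma [spin_sum_binavg]); with [L = 1 - 2 p (1 - s)] it is of the order of
    [L ^+ n / sqrt (1 + n p s)], by Cauchy-Schwarz from above ([tie_sqr_le]) and by
    Jensen from below ([tie_lower]). As [D - L = p (1 - s)^2], the quotient
    [(L / D) ^+ n] is [expR (- g)] up to a constant, with [g = n p (1 - s)^2].
    Finally [n p = k c ln 2 (1 + O(1 / k))] throughout the domain [x <= 1 / k^2],
    so [g = k gamma ln 2 / 2 + O(1)], which gives the two-sided estimate.

    Existence and uniqueness. Fixed points are the roots of the polynomial
    [gap_poly = x * total - tie] in [x]. It is nonpositive at [0], and nonnegative at
    [1 / k^2] because the ties are an exponentially small fraction of the total. Its
    derivative is positive ([deriv_gap_gt0]). The total decreases in [p], and [p]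
    decreases in [x], so that the first term has derivative at least the total. The
    derivative of the ties in [x] is at most [k (n p (1 - s) tie + L ^+ n)] up to
    constants ([deriv_tie_bound]); here [n p (1 - s)] can be exponentially large, but only
    when [s] is near [1], and then the factor [(n p s)^(-1/2)] in the weight of the
    ties reduces it to [sqrt g] ([tie_drift_le]). Hence the loss is polynomial in
    [k], against the factor [expR (- g)] with [g] at least a constant times [k].

    The hypothesis on [gamma] bounds [c] from below, by [c0 / 2], and thereby
    makes [d] larger than [k]. *)

(** * Binomial averages of a sequence *)

(** With [W_m = 'C(n, m) * (1 - a p)^(n-m) * (b p)^m], the value at [p] is
    [\sum_(m <= n) W_m * f m].  As an operator on [f] it is the [n]-th power of
    [1 - a p + b p * shift]; the recursion states just that, so that its properties
    follow by inductions in which [f] varies. *)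
Fixpoint binavg (R : comNzRingType) (a b : R) (n : nat) (f : nat -> R) : {poly R} :=
  if n is n'.+1 then
    (1 - a *: 'X) * binavg a b n' f + b *: 'X * binavg a b n' (fun m => f m.+1)
  else (f 0)%:P.

Section BinomialAverage.
Variables (R : realFieldType) (a b : R).
Implicit Types (n : nat) (f g : nat -> R) (p : R).

Lemma binavgS n f p :
  (binavg a b n.+1 f).[p] =
  (1 - a * p) * (binavg a b n f).[p] + b * p * (binavg a b n (fun m => f m.+1)).[p].
Proof. by rewrite /= !hornerE. Qed.

Lemma eq_binavg n f g p : f =1 g -> (binavg a b n f).[p] = (binavg a b n g).[p].
Proof.
elim: n f g => [|n IH] f g fg; first by rewrite /= fg.
by rewrite !binavgS (IH f g) // (IH (fun m => f m.+1) (fun m => g m.+1)).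
Qed.

Lemma binavg_lin n f g p (u v : R) :
  (binavg a b n (fun m => u * f m + v * g m)).[p] =
  u * (binavg a b n f).[p] + v * (binavg a b n g).[p].
Proof.
elim: n f g => [|n IH] f g; first by rewrite /= !hornerE.
by rewrite !binavgS IH (IH (fun m => f m.+1) (fun m => g m.+1)); ring.
Qed.

Lemma binavg_scale n f p (u : R) :
  (binavg a b n (fun m => u * f m)).[p] = u * (binavg a b n f).[p].
Proof.
rewrite -[RHS]addr0 -(mul0r (binavg a b n f).[p]) -binavg_lin.
by apply: eq_binavg => m; rewrite mul0r addr0.
Qed.

Lemma binavg1 n p : (binavg a b n (fun=> 1)).[p] = (1 - a * p + b * p) ^+ n.
Proof.
elim: n => [|n IH]; first by rewrite expr0 hornerC.
by rewrite binavgS IH exprS [in RHS]mulrDl.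
Qed.

Fact deriv_binavg_step (F G : {poly R}) p :
  ((1 - a *: 'X) * F + b *: 'X * G)^`().[p] =
  b * G.[p] - a * F.[p] + (1 - a * p) * F^`().[p] + b * p * G^`().[p].
Proof.
rewrite derivD !derivM derivB !derivZ derivX -polyC1 derivC !hornerE /=.
by ring.
Qed.

(** Differentiating the [n]-th power of the operator [1 - a p + b p * shift]. *)
Lemma deriv_binavg n f p :
  (binavg a b n.+1 f)^`().[p] =
  n.+1%:R * (b * (binavg a b n (fun m => f m.+1)).[p] - a * (binavg a b n f).[p]).
Proof.
elim: n f => [|n IH] f.
  by rewrite deriv_binavg_step /= !derivC !hornerC; ring.
rewrite deriv_binavg_step !IH !binavgS -[n.+2%:R]natr1.
by ring.
Qed.

(** The size-biasing identity [m * 'C(n.+1, m) = n.+1 * 'C(n, m.-1)]. *)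
Lemma binavg_size_bias n f p :
  (binavg a b n.+1 (fun m => m%:R * f m)).[p] =
  n.+1%:R * (b * p) * (binavg a b n (fun m => f m.+1)).[p].
Proof.
elim: n f => [|n IH] f.
  by rewrite /= !hornerE /=; ring.
rewrite binavgS IH.
rewrite (@eq_binavg _ (fun m => m.+1%:R * f m.+1)
  (fun m => 1 * (m%:R * f m.+1) + 1 * f m.+1)); last first.
  by move=> m /=; rewrite -natr1; ring.
rewrite binavg_lin (IH (fun m => f m.+1)) [in RHS]binavgS binavgS.
by rewrite -[n.+2%:R]natr1; ring.
Qed.

Section Positive.
Variable p : R.
Hypotheses (ap : 0 <= 1 - a * p) (bp : 0 <= b * p).

Lemma le_binavg n f g : (forall m, f m <= g m) ->
  (binavg a b n f).[p] <= (binavg a b n g).[p].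
Proof.
elim: n f g => [|n IH] f g fg; first by rewrite /= !hornerC.
by rewrite !binavgS lerD // ler_wpM2l // IH.
Qed.

Lemma binavg_ge0 n f : (forall m, 0 <= f m) -> 0 <= (binavg a b n f).[p].
Proof.
elim: n f => [|n IH] f f0; first by rewrite /= hornerC.
by rewrite binavgS addr_ge0 // mulr_ge0 // IH.
Qed.

Lemma binavg_le1 n f : (forall m, f m <= 1) ->
  (binavg a b n f).[p] <= (1 - a * p + b * p) ^+ n.
Proof. by move=> f1; rewrite -binavg1; exact: le_binavg. Qed.

Lemma binavg_mean n : n.+1%:R * (b * p) * (1 - a * p + b * p) ^+ n =
  (binavg a b n.+1 (fun m => m%:R)).[p].
Proof.
rewrite -binavg1 -(binavg_size_bias n (fun=> 1)).
by apply: eq_binavg => m; rewrite mulr1.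
Qed.

(** The first negative moment of a shifted binomial variable, read off from the
    size-biasing identity at the sequence [m^-1]. *)
Lemma binavg_inv n : n.+1%:R * (b * p) * (binavg a b n (fun m => m.+1%:R^-1)).[p] <=
  (1 - a * p + b * p) ^+ n.+1.
Proof.
rewrite -(binavg_size_bias n (fun m => m%:R^-1)); apply: binavg_le1 => -[|m].
  by rewrite mul0r.
by rewrite divff // pnatr_eq0.
Qed.

Lemma binavg_CS n f : (forall m, 0 <= f m) ->
  (binavg a b n f).[p] ^+ 2 <=
  (1 - a * p + b * p) ^+ n * (binavg a b n (fun m => f m ^+ 2)).[p].
Proof.
move=> f0; set E1 := (binavg a b n f).[p]; set E0 := _ ^+ n; set E2 := (_).[p].
have E0ge : 0 <= E0 by rewrite exprn_ge0 // addr_ge0.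
have E1ge : 0 <= E1 by exact: binavg_ge0.
(* positivity of the average of the square of [f - t], for every [t] *)
have quad t : 0 <= E2 - 2 * t * E1 + t ^+ 2 * E0.
  suff -> : E2 - 2 * t * E1 + t ^+ 2 * E0 =
      (binavg a b n (fun m => (f m - t) ^+ 2)).[p].
    by apply: binavg_ge0 => m; exact: sqr_ge0.
  rewrite (@eq_binavg _ (fun m => (f m - t) ^+ 2)
    (fun m => 1 * f m ^+ 2 + 1 * ((- 2 * t) * f m + t ^+ 2 * 1))).
    rewrite binavg_lin (binavg_lin _ f (fun=> 1)) binavg1 -/E0 -/E1 -/E2.
    by ring.
  by move=> m; ring.
have [E00|E0n] := eqVneq E0 0.
  have -> : E1 = 0; last by rewrite expr0n E00 mul0r.
  apply/eqP; rewrite eq_le E1ge andbT leNgt; apply/negP => E1gt.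
  have := quad ((E2 + 1) / E1); rewrite E00 mulr0 addr0 -mulrA divfK ?gt_eqF //.
  have E2ge : 0 <= E2 by apply: binavg_ge0 => m; exact: sqr_ge0.
  by lra.
have E0gt : 0 < E0 by rewrite lt_def E0n.
have := quad (E1 / E0).
rewrite -(pmulr_rge0 _ E0gt).
have -> : E0 * (E2 - 2 * (E1 / E0) * E1 + (E1 / E0) ^+ 2 * E0) = E0 * E2 - E1 ^+ 2.
  by field.
by rewrite subr_ge0.
Qed.

End Positive.
End BinomialAverage.

(** * The normalized central binomial coefficients *)

(** The probability that a simple random walk is back at its start after [2m]
    steps. *)
Definition central (R : realFieldType) (m : nat) : R := 'C(m.*2, m)%:R / 4 ^+ m.

Section CentralBinomial.
Variable R : realFieldType.
Local Notation u := (central R).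

Lemma central0 : u 0 = 1.
Proof. by rewrite /central bin0 expr0 divr1. Qed.

Lemma centralS m : (2 * m.+1%:R) * u m.+1 = (2 * m%:R + 1) * u m.
Proof.
rewrite /central.
have nat_rec : (m.+1 * 'C(m.+1.*2, m.+1) = 2 * (m.*2.+1 * 'C(m.*2, m)))%N.
  rewrite doubleS -mul_bin_diag /=.
  have -> : 'C(m.*2.+1, m) = 'C(m.*2.+1, m.+1).
    rewrite -[in RHS]bin_sub; last by rewrite ltnS -addnn leq_addr.
    by congr 'C(_, _); rewrite subSS -addnn addnK.
  by rewrite -doubleS -muln2 -mulnA mulnCA -mul_bin_diag.
have := congr1 (GRing.natmul (1 : R)) nat_rec.
rewrite !natrM -[m.*2.+1%:R]natr1 -[in m.*2%:R]mul2n natrM => ratio.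
rewrite exprS -mulrA [X in 2 * X]mulrA ratio.
have : (4 : R) ^+ m != 0 by rewrite expf_neq0 // pnatr_eq0.
by move=> h; field.
Qed.

Lemma central_gt0 m : 0 < u m.
Proof.
by rewrite divr_gt0 ?exprn_gt0 ?ltr0n ?bin_gt0 // -addnn leq_addr.
Qed.

(** The discrete form of differentiating [m^(-1/2)], which gains a factor [1/m]. It
    is what makes the total effect of the half-steps on the ties bounded. *)
Lemma central_diff m : u m - u m.+1 = u m / (2 * m.+1%:R).
Proof.
have m0 : (m.+1%:R : R) != 0 by rewrite pnatr_eq0.
apply: (@mulfI _ (2 * m.+1%:R)); first by rewrite mulf_neq0 // pnatr_eq0.
rewrite mulrBr centralS -[m.+1%:R]natr1; rewrite -[m.+1%:R]natr1 in m0.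
by field.
Qed.

Lemma central_le m : u m.+1 <= u m.
Proof.
by rewrite -subr_ge0 central_diff divr_ge0 ?mulr_ge0 // ltW // central_gt0.
Qed.

Lemma central_le1 m : u m <= 1.
Proof.
by elim: m => [|m]; [rewrite central0 | apply: le_trans; exact: central_le].
Qed.

Lemma central_diff_le m : u m - u m.+1 <= 2^-1 * m.+1%:R^-1.
Proof.
rewrite central_diff invfM mulrA -[leRHS]mul1r mulrA.
by rewrite ler_wpM2r ?invr_ge0 // ler_wpM2r ?invr_ge0 // central_le1.
Qed.

(** Induction: [(2m+1) * u m ^ 2] decreases, by [(2m+1)(2m+3) <= (2m+2)^2]. *)
Lemma central_sqr_le m : u m ^+ 2 <= m.+1%:R^-1.
Proof.
have main : (2 * m%:R + 1) * u m ^+ 2 <= 1.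
  elim: m => [|m IH]; first by rewrite central0 mulr0 add0r expr1n mulr1.
  have e := centralS m; set v := u m.+1 in e *; set w := u m in IH e.
  rewrite -[m.+1%:R]natr1 in e *; have m0 := ler0n R m; set x := m%:R in IH e m0 *.
  have x1 : 0 < (2 * (x + 1)) ^+ 2 by apply: exprn_gt0; lra.
  rewrite -(ler_pM2l x1) mulr1.
  have -> : (2 * (x + 1)) ^+ 2 * ((2 * (x + 1) + 1) * v ^+ 2) =
      (2 * (x + 1) + 1) * (2 * (x + 1) * v) ^+ 2 by ring.
  rewrite e.
  have -> : (2 * (x + 1) + 1) * ((2 * x + 1) * w) ^+ 2 =
      (2 * x + 3) * (2 * x + 1) * ((2 * x + 1) * w ^+ 2) by ring.
  have : (2 * x + 3) * (2 * x + 1) * ((2 * x + 1) * w ^+ 2) <=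
      (2 * x + 3) * (2 * x + 1) * 1 by rewrite ler_wpM2l // mulr_ge0 //; lra.
  by move=> /le_trans; apply; nra.
rewrite -[leRHS]mul1r ler_pdivlMr ?ltr0Sn //.
apply: le_trans main; rewrite mulrC ler_wpM2r ?sqr_ge0 // -[m.+1%:R]natr1 lerD2r.
by have := ler0n R m; lra.
Qed.

(** Induction: [m * u m ^ 2] increases, by [(2m+1)^2 >= 4 m (m+1)]. *)
Lemma central_sqr_ge m : 1 <= 4 * m.+1%:R * u m ^+ 2.
Proof.
case: m => [|m]; first by rewrite central0 expr1n !mulr1; lra.
have main : 1 <= 4 * m.+1%:R * u m.+1 ^+ 2.
  elim: m => [|m IH].
    have := centralS 0; rewrite central0 mulr0 add0r !mulr1 => e.
    by have -> : u 1 = 2^-1; [lra | rewrite expr2; lra].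
  have e := centralS m.+1; set v := u m.+2 in e *; set w := u m.+1 in IH e.
  rewrite -[m.+2%:R]natr1 in e *.
  have m0 : 0 < m.+1%:R :> R by rewrite ltr0n.
  set x := m.+1%:R in IH e m0 *.
  have x1 : 0 < (x + 1) by lra.
  rewrite -(ler_pM2l x1) mulr1.
  have -> : (x + 1) * (4 * (x + 1) * v ^+ 2) = (2 * (x + 1) * v) ^+ 2 by ring.
  rewrite e -(ler_pM2l m0).
  have : (2 * x + 1) ^+ 2 * 1 <= (2 * x + 1) ^+ 2 * (4 * x * w ^+ 2).
    by rewrite ler_wpM2l // sqr_ge0.
  by have := sqr_ge0 x; nra.
apply: le_trans main _; rewrite ler_wpM2r ?sqr_ge0 // ler_wpM2l //.
by rewrite ler_nat.
Qed.

End CentralBinomial.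

(** * Weight of the ties and total weight *)

(** The two sums behind the update of [q spinf]: [tie_poly s n] and
    [total_poly s n], evaluated at [p], are the weight of the [b] with
    [ell spin0 b = ell spin1 b] and the weight of all [b], among [n] messages
    that are [spin0], [spin1] with probability [p] each, for the tilt
    [s = expR (- y / 2)]. *)
Definition tie_poly (R : realFieldType) (s : R) (n : nat) : {poly R} :=
  binavg (2 * (1 + s)) (4 * s) n (central R).

Fixpoint total_poly (R : realFieldType) (s : R) (n : nat) : {poly R} :=
  if n is n'.+1 then
    (1 - (1 - s ^+ 2) *: 'X) * total_poly s n' + (1 - s ^+ 2) *: 'X * tie_poly s n'
  else 1.

(** [D ^+ n] is the exponential size of the total weight and [L ^+ n] that of the
    ties. The bound [p <= 1/8] keeps [L], [D] and the weight of no step away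
    from [0]. *)
Section TieTotal.
Variables (R : realFieldType) (s p : R).
Hypotheses (s0 : 0 <= s) (s1 : s <= 1) (p0 : 0 <= p) (p8 : p <= 8^-1).

Local Notation N n := (tie_poly s n).[p].
Local Notation Z n := (total_poly s n).[p].
Local Notation L := (1 - 2 * p * (1 - s)).
Local Notation D := (1 - p * (1 - s ^+ 2)).
Local Notation u := (central R).
Local Notation avg n f := (binavg (2 * (1 + s)) (4 * s) n f).[p].

Fact ps_bounds : [/\ 0 <= p * s, p * s <= p, 0 <= p * s ^+ 2 & p * s ^+ 2 <= p].
Proof.
split; first exact: mulr_ge0.
- by rewrite ler_piMr.
- by rewrite mulr_ge0 // exprn_ge0.
- by rewrite ler_piMr // exprn_ile1.
Qed.

Fact free_weight_ge0 : 0 <= 1 - 2 * (1 + s) * p.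
Proof. by move: s0 s1 p0 p8; have [? ? ? ?] := ps_bounds; lra. Qed.
Local Notation ap := free_weight_ge0.

Fact pair_weight_ge0 : 0 <= 4 * s * p.
Proof. by move: s0 s1 p0 p8; have [? ? ? ?] := ps_bounds; lra. Qed.
Local Notation bp := pair_weight_ge0.

Fact sum_weights : 1 - 2 * (1 + s) * p + 4 * s * p = L.
Proof. by ring. Qed.
Local Notation Lsum := sum_weights.

Lemma LD_bounds : [/\ 2^-1 <= L, L <= 1, 2^-1 <= D & D <= 1].
Proof. by move: s0 s1 p0 p8; have [? ? ? ?] := ps_bounds; split; lra. Qed.

#[local] Hint Resolve free_weight_ge0 pair_weight_ge0 : core.

Lemma tie_polyS n : N n.+1 =
  (1 - 2 * (1 + s) * p) * N n + 4 * s * p * avg n (fun m => u m.+1).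
Proof. exact: binavgS. Qed.

Lemma tie_ge0 n : 0 <= N n.
Proof. by apply: binavg_ge0 => // m; exact/ltW/central_gt0. Qed.

Lemma tie_le n : N n <= L ^+ n.
Proof. by rewrite -Lsum; apply: binavg_le1 => // m; exact: central_le1. Qed.

(** By Cauchy-Schwarz, [E(central M) <= E(1 / (M + 1))^(1/2)] for the binomial number
    [M] of pairs of half-steps. *)
Lemma tie_sqr_le n : N n ^+ 2 * (4 * n.+1%:R * (p * s)) <= (L ^+ n) ^+ 2.
Proof.
have CS := @binavg_CS _ _ _ _ ap bp n _ (fun m => ltW (central_gt0 R m)).
have sq : avg n (fun m => u m ^+ 2) <= avg n (fun m => m.+1%:R^-1).
  by apply: le_binavg => // m; exact: central_sqr_le.
have inv := @binavg_inv _ _ _ _ ap bp n.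
rewrite Lsum in CS inv.
have nbp : 0 <= n.+1%:R * (4 * s * p) by rewrite mulr_ge0.
have Ln : 0 <= L ^+ n by rewrite exprn_ge0 //; have [? ? ? ?] := LD_bounds; lra.
have := ler_wpM2r nbp (le_trans CS (ler_wpM2l Ln sq)).
have -> : N n ^+ 2 * (4 * n.+1%:R * (p * s)) =
  (avg n u) ^+ 2 * (n.+1%:R * (4 * s * p)) by rewrite /tie_poly; ring.
move=> /le_trans; apply; rewrite -mulrA expr2 ler_wpM2l //.
rewrite mulrC; apply: le_trans inv _.
by rewrite exprS ler_piMl //; have [] := LD_bounds.
Qed.

(** Jensen's inequality for the convex function [v^(-1/2)], in the form of its
    tangent at the mean. *)
Lemma tie_lower n (t : R) : 0 <= t -> t ^+ 2 * (1 + 8 * n%:R * (p * s)) = 1 ->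
  t * L ^+ n <= 2 * N n.
Proof.
move=> t0 tE.
have Ln : 0 <= L ^+ n by rewrite exprn_ge0 //; have [? ? ? ?] := LD_bounds; lra.
have mean : avg n (fun m => m%:R) <= 8 * n%:R * (p * s) * L ^+ n.
  case: n {tE} Ln => [|n] Ln; first by rewrite /= hornerC; lra.
  rewrite -binavg_mean // Lsum exprS.
  have -> : 8 * n.+1%:R * (p * s) * (L * L ^+ n) =
    n.+1%:R * (4 * s * p) * ((2 * L) * L ^+ n) by ring.
  rewrite ler_wpM2l ?mulr_ge0 // -[leLHS]mul1r ler_wpM2r //.
    by rewrite exprn_ge0 //; have [? ? ? ?] := LD_bounds; lra.
  by have [? ? ? ?] := LD_bounds; lra.
(* [central m] is at least [v^(-1/2) / 2] at [v = m + 1]; this is its tangent at [t^-2] *)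
have tangent m : 3 / 4 * t * 1 + (- (t ^+ 3 / 4)) * (1 * m%:R + 1 * 1) <= u m.
  have um := central_gt0 R m; have um2 := central_sqr_ge R m.
  rewrite -[m.+1%:R]natr1 in um2; set x := m%:R in um2 *; set v := u m in um um2 *.
  have v2 : 0 < v ^+ 2 by rewrite exprn_gt0.
  rewrite -(ler_pM2l (mulr_gt0 (ltr0n R 16) v2)).
  have cube : 0 <= (2 * v - t) ^+ 2 * (4 * v + t).
    by rewrite mulr_ge0 ?sqr_ge0 //; lra.
  have t3 : 0 <= t ^+ 3 by rewrite exprn_ge0.
  have := ler_wpM2l t3 um2.
  by nra.
have := @le_binavg _ _ _ _ ap bp n _ _ tangent.
rewrite (binavg_lin _ _ n (fun=> 1) (fun m => 1 * m%:R + 1 * 1)).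
rewrite (binavg_lin _ _ n (fun m => m%:R) (fun=> 1)) binavg1 Lsum.
rewrite -/(tie_poly s n) => low.
have t3 : 0 <= t ^+ 3 by rewrite exprn_ge0.
have := ler_wpM2l t3 mean.
have -> : t ^+ 3 * (8 * n%:R * (p * s) * L ^+ n) = (t - t ^+ 3) * L ^+ n.
  have -> : t - t ^+ 3 = t * (t ^+ 2 * (1 + 8 * n%:R * (p * s)) - t ^+ 2).
    by rewrite tE; ring.
  by ring.
set E := L ^+ n in low *; set M := avg n _ in low *.
by nra.
Qed.

Fact avg_shift n : 0 <= avg n u - avg n (fun m => u m.+1).
Proof. by rewrite subr_ge0 le_binavg // => m; exact: central_le. Qed.

(** [central] decreases, so a further pair of half-steps lowers the average. *)
Lemma tie_le_pred n : N n.+1 <= N n.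
Proof.
rewrite tie_polyS -subr_ge0.
set A := avg n _.
have -> : N n - ((1 - 2 * (1 + s) * p) * N n + 4 * s * p * A) =
  (1 - L) * N n + 4 * s * p * (N n - A) by ring.
have [? ? ? ?] := LD_bounds.
rewrite addr_ge0 ?mulr_ge0 ?tie_ge0 ?subr_ge0 //.
by have := avg_shift n; rewrite subr_ge0.
Qed.

Lemma deriv_tie n : (tie_poly s n.+1)^`().[p] =
  - (n.+1%:R * (2 * (1 - s) * N n + 4 * s * (N n - avg n (fun m => u m.+1)))).
Proof. by rewrite deriv_binavg -/(tie_poly s n); ring. Qed.

Lemma deriv_tie_le0 n : (tie_poly s n)^`().[p] <= 0.
Proof.
case: n => [|n]; first by rewrite /tie_poly /= derivC hornerC.
rewrite deriv_tie oppr_le0 mulr_ge0 // addr_ge0 //.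
  by rewrite !mulr_ge0 ?tie_ge0 ?subr_ge0.
by rewrite !mulr_ge0 //; exact: avg_shift.
Qed.

(** Up to replacing [central m] by [central m.+1], turning a free message into a
    decided one costs a tie only a factor [1 - s]; this is the first term. By
    [central_diff] and [binavg_inv] the replacement contributes no more than the
    order of a single message in total, however large [n * p * s] is. *)
Lemma deriv_tie_bound n : - (p * (tie_poly s n.+1)^`().[p]) <=
  2 * (n.+1%:R * p * (1 - s)) * N n + 2^-1 * L ^+ n.+1.
Proof.
have inv := @binavg_inv _ _ _ _ ap bp n; rewrite Lsum in inv.
have diff : N n - avg n (fun m => u m.+1) <= 2^-1 * avg n (fun m => m.+1%:R^-1).
  rewrite /tie_poly -binavg_scale.
  have -> : avg n u - avg n (fun m => u m.+1) = avg n (fun m => 1 * u m + (-1) * u m.+1).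
    by rewrite (binavg_lin _ _ n u (fun m => u m.+1)); ring.
  by apply: le_binavg => // m /=; rewrite mul1r mulN1r central_diff_le.
rewrite deriv_tie mulrN opprK.
have nbp : 0 <= n.+1%:R * (4 * s * p) by rewrite mulr_ge0.
have := ler_wpM2l nbp diff.
set A := avg n _ in inv *; set B := avg n _.
set E := L ^+ n.+1 in inv *.
by nra.
Qed.

Lemma total_polyS n : Z n.+1 = D * Z n + (1 - D) * N n.
Proof. by rewrite /= !hornerE /=; ring. Qed.

Lemma tie_le_total n : N n <= Z n.
Proof.
elim: n => [|n IH]; first by rewrite /tie_poly /= hornerC central0 hornerE.
rewrite total_polyS; apply: le_trans (tie_le_pred n) _.
have D0 : 0 <= D by have [? ? ? ?] := LD_bounds; lra.
by have := ler_wpM2l D0 IH; lra.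
Qed.

Lemma total_ge n : D ^+ n <= Z n.
Proof.
elim: n => [|n IH]; first by rewrite /= hornerE expr0.
have D0 : 0 <= D by have [? ? ? ?] := LD_bounds; lra.
have D1 : 0 <= 1 - D by have [? ? ? ?] := LD_bounds; lra.
rewrite total_polyS exprS.
by have := ler_wpM2l D0 IH; have := mulr_ge0 D1 (tie_ge0 n); lra.
Qed.

Lemma total_gt0 n : 0 < Z n.
Proof. by apply: lt_le_trans (total_ge n); rewrite exprn_gt0 //; have [? ? ? ?] := LD_bounds; lra. Qed.

Fact deriv_total_step (F G : {poly R}) (c : R) :
  ((1 - c *: 'X) * F + c *: 'X * G)^`().[p] =
  c * (G.[p] - F.[p]) + (1 - c * p) * F^`().[p] + c * p * G^`().[p].
Proof.
rewrite derivD !derivM derivB !derivZ derivX -polyC1 derivC !hornerE /=.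
by ring.
Qed.

(** In the recursion of [total_poly], raising [p] moves mass from [total_poly] to the
    smaller [tie_poly], and both already decrease by induction. *)
Lemma deriv_total_le0 n : (total_poly s n)^`().[p] <= 0.
Proof.
elim: n => [|n IH]; first by rewrite /= -polyC1 derivC hornerC.
rewrite deriv_total_step.
have D0 : 0 <= D by have [? ? ? ?] := LD_bounds; lra.
have c0 : 0 <= 1 - s ^+ 2 by rewrite subr_ge0 exprn_ile1.
have t1 : (1 - s ^+ 2) * (N n - Z n) <= 0.
  by rewrite mulr_ge0_le0 // subr_le0 tie_le_total.
have t2 : (1 - (1 - s ^+ 2) * p) * (total_poly s n)^`().[p] <= 0.
  by rewrite [_ * p]mulrC mulr_ge0_le0.
have t3 : (1 - s ^+ 2) * p * (tie_poly s n)^`().[p] <= 0.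
  by rewrite mulr_ge0_le0 ?mulr_ge0 // deriv_tie_le0.
by lra.
Qed.

End TieTotal.

(** * Sums over spin configurations *)

(** The form of all the sums that define the survey propagation maps: they see
    a configuration only through its numbers of [spin0] and [spin1]. *)
Definition spin_sum (R : comNzRingType) (n : nat) (q : {ffun spin -> R})
    (F : nat -> nat -> R) : R :=
  \sum_(b : {ffun 'I_n -> spin}) F (ell spin0 b) (ell spin1 b) * \prod_(i < n) q (b i).

Definition ffun_cons (T : Type) (n : nat) (h : T) (b : {ffun 'I_n -> T}) :
    {ffun 'I_n.+1 -> T} :=
  [ffun i => if unlift ord0 i is Some j then b j else h].

Lemma sum_spin (V : nmodType) (F : spin -> V) :
  \sum_h F h = F spinf + F spin0 + F spin1.
Proof.
by rewrite (bigD1 spinf) // (bigD1 spin0) // (bigD1 spin1) //= big_pred0 ?addr0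
           ?addrA // => -[[]|].
Qed.

Lemma ell_cons n (h g : spin) (b : {ffun 'I_n -> spin}) :
  ell h (ffun_cons g b) = ((g == h) + ell h b)%N.
Proof.
rewrite /ell -!sum1_card big_mkcond [in RHS]big_mkcond big_ord_recl /=.
congr (_ + _)%N; first by rewrite inE ffunE unlift_none; case: (g == h).
by apply: eq_bigr => i _; rewrite !inE ffunE liftK.
Qed.

Lemma coef_1DXn (R : nzRingType) n i : ((1 + 'X) ^+ n : {poly R})`_i = 'C(n, i)%:R.
Proof.
rewrite addrC exprD1n.
have -> : \sum_(j < n.+1) 'X^j *+ 'C(n, j) = \poly_(j < n.+1) ('C(n, j)%:R : R).
  by rewrite poly_def; apply: eq_bigr => j _; rewrite scaler_nat.
by rewrite coef_poly ltnS; case: leqP => // /bin_small ->.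
Qed.

Section SpinSum.
Variables (R : realFieldType) (q : {ffun spin -> R}).
Implicit Types (n : nat) (F G : nat -> nat -> R).

Lemma spin_sum0 F : spin_sum 0 q F = F 0 0.
Proof.
have ell0 h (b : {ffun 'I_0 -> spin}) : ell h b = 0%N.
  by have := max_card [set i | b i == h]; rewrite card_ord leqn0 => /eqP.
rewrite /spin_sum (bigD1 [ffun=> spinf]) //= ?big_ord0 mulr1 !ell0 big1 ?addr0 //.
by move=> b /eqP[]; apply/ffunP => -[].
Qed.

(** Conditioning on the first message. *)
Lemma spin_sumS n F : spin_sum n.+1 q F =
  q spinf * spin_sum n q F + q spin0 * spin_sum n q (fun i j => F i.+1 j) +
  q spin1 * spin_sum n q (fun i j => F i j.+1).
Proof.
rewrite /spin_sum.
rewrite (reindex (fun hb : spin * {ffun 'I_n -> spin} => ffun_cons hb.1 hb.2)) /=; last first.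
  exists (fun b : {ffun 'I_n.+1 -> spin} => (b ord0, [ffun i => b (lift ord0 i)])).
    move=> [h b] _ /=; congr (_, _); first by rewrite ffunE unlift_none.
    by apply/ffunP => i; rewrite !ffunE liftK.
  move=> b _; apply/ffunP => i; rewrite !ffunE /=.
  by case: unliftP => [j|] -> //; rewrite ffunE.
rewrite -(pair_bigA _ (fun h b => F (ell spin0 (ffun_cons h b)) (ell spin1 (ffun_cons h b)) *
  \prod_(i < n.+1) q (ffun_cons h b i))) /=.
have term h b : F (ell spin0 (ffun_cons h b)) (ell spin1 (ffun_cons h b)) *
    \prod_(i < n.+1) q (ffun_cons h b i) =
    q h * (F ((h == spin0) + ell spin0 b)%N ((h == spin1) + ell spin1 b)%N *
           \prod_(i < n) q (b i)).
  rewrite !ell_cons big_ord_recl ffunE unlift_none mulrCA; congr (_ * (_ * _)).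
  by apply: eq_bigr => i _; rewrite ffunE liftK.
rewrite sum_spin !mulr_sumr; congr (_ + _ + _); apply: eq_bigr => b _.
all: by rewrite term.
Qed.

Lemma eq_spin_sum n F G : (forall i j, F i j = G i j) ->
  spin_sum n q F = spin_sum n q G.
Proof. by move=> FG; apply: eq_bigr => b _; rewrite FG. Qed.

Lemma spin_sum_lin n F G (u v : R) :
  spin_sum n q (fun i j => u * F i j + v * G i j) =
  u * spin_sum n q F + v * spin_sum n q G.
Proof.
rewrite /spin_sum !mulr_sumr -big_split; apply: eq_bigr => b _ /=.
by ring.
Qed.

Lemma spin_sum_scale n F (u : R) :
  spin_sum n q (fun i j => u * F i j) = u * spin_sum n q F.
Proof. by rewrite /spin_sum mulr_sumr; apply: eq_bigr => b _; rewrite mulrA. Qed.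

Lemma le_spin_sum n F G : (forall h, 0 <= q h) -> (forall i j, F i j <= G i j) ->
  spin_sum n q F <= spin_sum n q G.
Proof.
move=> q0 FG; apply: ler_sum => b _; rewrite ler_wpM2r //.
by apply: prodr_ge0 => i _; exact: q0.
Qed.

Lemma spin_sum_geom n (t u : R) : spin_sum n q (fun i j => t ^+ i * u ^+ j) =
  (q spinf + q spin0 * t + q spin1 * u) ^+ n.
Proof.
elim: n => [|n IH]; first by rewrite spin_sum0 !expr0 mulr1.
rewrite spin_sumS exprS -IH.
rewrite (@eq_spin_sum _ (fun i j => t ^+ i.+1 * u ^+ j)
  (fun i j => t * (t ^+ i * u ^+ j))); last by move=> i j; rewrite exprS mulrA.
rewrite (@eq_spin_sum _ (fun i j => t ^+ i * u ^+ j.+1)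
  (fun i j => u * (t ^+ i * u ^+ j))); last by move=> i j; rewrite exprS mulrCA.
by rewrite !spin_sum_scale; ring.
Qed.

Lemma spin_sum_swap n F : q spin0 = q spin1 ->
  spin_sum n q F = spin_sum n q (fun i j => F j i).
Proof.
move=> q01; elim: n F => [|n IH] F; first by rewrite !spin_sum0.
by rewrite !spin_sumS IH (IH (fun i j => F i.+1 j)) (IH (fun i j => F i j.+1)) q01 addrAC.
Qed.

Section Symmetric.
Variables (s p : R).
Hypotheses (q0 : q spin0 = p) (q1 : q spin1 = p) (qf : q spinf = 1 - 2 * p).

(** The weight of a tie is a coefficient of [((1-2p) 'X + p s 'X^2 + p s)^n].
    Since [(1-2p) 'X + p s 'X^2 + p s = (1 - 2(1+s)p) 'X + p s (1 + 'X)^2], it is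
    a binomial average of central binomial coefficients: a lazy step of the
    difference [ell spin0 b - ell spin1 b] is a pair of simple half-steps with
    probability proportional to [4 s p], and no step otherwise. The induction
    runs over all starting polynomials [(1 + 'X)^(2c)]. *)
Lemma spin_sum_binavg n c :
  spin_sum n q (fun i j => s ^+ (i + j) * ('X^i * (1 + 'X) ^+ (c.*2))`_(j + c) / 4 ^+ c) =
  (binavg (2 * (1 + s)) (4 * s) n (fun m => central R (m + c))).[p].
Proof.
elim: n c => [|n IH] c.
  rewrite spin_sum0 /= hornerC /central expr0 mul1r mul1r !add0n; congr (_ / _).
  by rewrite coef_1DXn.
rewrite spin_sumS binavgS -IH.
rewrite (@eq_binavg _ _ _ _ (fun m => central R (m.+1 + c)) (fun m => central R (m + c.+1))); last first.
  by move=> m; rewrite addSnnS.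
rewrite -IH q0 q1 qf.
set F := fun i j => _; set F0 := fun i j => _; set F1 := fun i j => _.
set G := fun i j => _.
have step i j : 4 * s * G i j = 1 * (2 * s * F i j + 1 * F0 i j) + 1 * F1 i j.
  pose W : {poly R} := 'X^i * (1 + 'X) ^+ c.*2.
  have GW : 'X^i * (1 + 'X) ^+ c.+1.*2 = W + W * 'X + W * 'X + W * 'X * 'X.
    by rewrite doubleS !exprS /W; ring.
  have F0W : 'X^(i.+1) * (1 + 'X) ^+ c.*2 = W * 'X by rewrite exprS /W; ring.
  rewrite /F /F0 /F1 /G GW F0W -/W.
  rewrite !coefD !coefMX addnS addSn /=.
  have : (4 : R) ^+ c != 0 by rewrite expf_neq0 // pnatr_eq0.
  by rewrite addSn addnS !exprS; case: (j + c)%N => [|w] /= h; field.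
have -> : 4 * s * p * spin_sum n q G = p * (4 * s * spin_sum n q G) by ring.
have -> : 4 * s * spin_sum n q G = 2 * s * spin_sum n q F + spin_sum n q F0 + spin_sum n q F1.
  rewrite -spin_sum_scale (eq_spin_sum _ step) spin_sum_lin (spin_sum_lin _ F F0).
  by ring.
by ring.
Qed.

Lemma spin_sum_tie n :
  spin_sum n q (fun i j => if i == j then s ^+ (2 * minn i j) else 0) = (tie_poly s n).[p].
Proof.
rewrite /tie_poly.
rewrite (@eq_binavg _ _ _ _ (central R) (fun m => central R (m + 0))); last first.
  by move=> m; rewrite addn0.
rewrite -spin_sum_binavg; apply: eq_spin_sum => i j.
rewrite double0 !expr0 mulr1 ?divr1 addn0 coefXn eq_sym.
by case: eqP => [->|_]; [rewrite minnn mul2n addnn mulr1 | rewrite mulr0].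
Qed.

(** A message increases [minn] for the minority sign only. So the next message
    multiplies the weight of an untied configuration by [(1 - 2p) + p + p s^2], which
    is [D], and that of a tie by [1]; this is the recursion of [total_poly]. *)
Lemma spin_sum_total n :
  spin_sum n q (fun i j => s ^+ (2 * minn i j)) = (total_poly s n).[p].
Proof.
elim: n => [|n IH]; first by rewrite spin_sum0 minnn muln0 expr0 /= hornerE.
rewrite total_polyS -IH -spin_sum_tie spin_sumS q0 q1 qf.
set F := fun i j => _; set F0 := fun i j => _; set F1 := fun i j => _.
set G := fun i j => _.
have step i j : 1 * F0 i j + 1 * F1 i j = (1 + s ^+ 2) * F i j + (1 - s ^+ 2) * G i j.
  rewrite /F /F0 /F1 /G; case: (ltngtP i j) => [ij|ji|->].
  - by rewrite (minn_idPl ij) (minn_idPl (leqW (ltnW ij))) mulnS exprD; ring.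
  - by rewrite (minn_idPr ji) (minn_idPr (leqW (ltnW ji))) mulnS exprD; ring.
  by rewrite (minn_idPr (leqnSn j)) (minn_idPl (leqnSn j)) ?minnn; ring.
have := @spin_sum_lin n F0 F1 1 1.
rewrite (eq_spin_sum _ step) spin_sum_lin !mul1r => e.
have -> : (1 - 2 * p) * spin_sum n q F + p * spin_sum n q F0 + p * spin_sum n q F1 =
  (1 - 2 * p) * spin_sum n q F + p * (spin_sum n q F0 + spin_sum n q F1) by ring.
by rewrite -e; ring.
Qed.

(** [s ^+ (2 * minn i j)] is one of the product weights [s ^+ (2 * i)] and
    [s ^+ (2 * j)], hence at most their sum, and each of these sums to [D ^+ n]. *)
Lemma total_le n : (forall h, 0 <= q h) -> 0 <= s ->
  (total_poly s n).[p] <= 2 * (1 - p * (1 - s ^+ 2)) ^+ n.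
Proof.
move=> qge0 s0; rewrite -spin_sum_total.
have -> : 2 * (1 - p * (1 - s ^+ 2)) ^+ n = spin_sum n q (fun i j =>
   1 * ((s ^+ 2) ^+ i * 1 ^+ j) + 1 * (1 ^+ i * (s ^+ 2) ^+ j)).
  rewrite (spin_sum_lin _ (fun i j => (s ^+ 2) ^+ i * 1 ^+ j)) !spin_sum_geom q0 q1 qf.
  have -> : 1 - 2 * p + p * s ^+ 2 + p * 1 = 1 - p * (1 - s ^+ 2) by ring.
  have -> : 1 - 2 * p + p * 1 + p * s ^+ 2 = 1 - p * (1 - s ^+ 2) by ring.
  by ring.
apply: le_spin_sum => // i j; rewrite !expr1n mulr1 !mul1r -!exprM.
have [ij|ji] := leqP i j.
  by rewrite lerDl exprn_ge0.
by rewrite lerDr exprn_ge0.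
Qed.

End Symmetric.
End SpinSum.

(** * Reduction to one unknown *)

Section Reduction.
Variable R : realType.
Implicit Types q : {ffun spin -> R}.

Lemma calM_half q : calM q -> q spin0 = (1 - q spinf) / 2 /\ q spin1 = (1 - q spinf) / 2.
Proof. by case=> _; rewrite sum_spin => sum1 sym; split; lra. Qed.

Lemma calM_ext q q' : calM q -> calM q' -> q spinf = q' spinf -> q = q'.
Proof.
move=> /calM_half[a0 a1] /calM_half[b0 b1] ff; apply/ffunP => -[[]|] //.
  by rewrite a1 b1 ff.
by rewrite a0 b0 ff.
Qed.

Definition calM_of (x : R) : {ffun spin -> R} :=
  [ffun h => if h is Some _ then (1 - x) / 2 else x].

Lemma calM_of_spinf x : calM_of x spinf = x.
Proof. by rewrite ffunE. Qed.

Lemma calM_ofP x : 0 <= x <= 1 -> calM (calM_of x).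
Proof.
case/andP=> x0 x1; split.
- by case=> [?|]; rewrite ffunE //; lra.
- by rewrite sum_spin !ffunE; lra.
- by rewrite !ffunE.
Qed.

(** The probability that a clause forces a given value, when a variable message
    is [spinf] with probability [x]: all the [k - 1] other messages agree. *)
Definition force_poly (k : nat) : {poly R} := (2^-1 *: (1 - 'X)) ^+ k.-1.

Lemma force_polyE k x : (force_poly k).[x] = ((1 - x) / 2) ^+ k.-1.
Proof. by rewrite /force_poly horner_exp !hornerE mulrC. Qed.

Lemma hatSP_sum k q : \sum_h hatSP k q h = (\sum_h q h) ^+ k.-1.
Proof.
have -> : (\sum_h q h) ^+ k.-1 = \prod_(i < k.-1) \sum_h q h.
  by rewrite prodr_const card_ord.
rewrite bigA_distr_bigA /=.
rewrite (partition_big (@hatW k.-1) xpredT) //=; apply: eq_bigr => h _.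
by rewrite ffunE; apply: eq_bigl => u; rewrite eq_sym.
Qed.

Lemma hatSPE k q : (1 < k)%N -> calM q ->
  let p := (force_poly k).[q spinf] in
  [/\ hatSP k q spin0 = p, hatSP k q spin1 = p & hatSP k q spinf = 1 - 2 * p].
Proof.
move=> k1 qM p; have [q0 q1] := calM_half qM.
have k0 : (0 < k.-1)%N by case: k {p} k1 => [|[]].
have h0 : hatSP k q spin0 = p.
  rewrite ffunE (big_pred1 [ffun=> spin1]) => [|u].
    rewrite (eq_bigr (fun=> q spin1)) => [|i _]; last by rewrite ffunE.
    by rewrite prodr_const card_ord q1 /p force_polyE.
  rewrite /hatW /=; case: forallP => [u1|nu1].
    by rewrite eqxx; apply/esym/eqP/ffunP => i; rewrite ffunE; exact/eqP.
  have -> : (u == [ffun=> spin1]) = false.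
    by apply/eqP => uE; apply: nu1 => i; rewrite uE ffunE.
  by case: ifP.
have h1 : hatSP k q spin1 = p.
  rewrite ffunE (big_pred1 [ffun=> spin0]) => [|u].
    rewrite (eq_bigr (fun=> q spin0)) => [|i _]; last by rewrite ffunE.
    by rewrite prodr_const card_ord q0 /p force_polyE.
  rewrite /hatW /=; case: forallP => [u1|_].
    apply/esym/negbTE/eqP => uE; have := u1 (Ordinal k0).
    by rewrite uE ffunE.
  case: forallP => [u0|nu0].
    by rewrite eqxx; apply/esym/eqP/ffunP => i; rewrite ffunE; exact/eqP.
  by apply/esym/eqP => uE; apply: nu0 => i; rewrite uE ffunE.
split=> //; have := hatSP_sum k q.
have [_ -> _] := qM; rewrite expr1n sum_spin h0 h1; lra.
Qed.

Lemma dotSP_weight_sum d y (q : {ffun spin -> R}) (P : spin -> bool) :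
  \sum_(b : {ffun 'I_d.-1 -> spin} | P (dotW b)) dotSP_weight y q b =
  spin_sum d.-1 q (fun i j =>
    if P (if (j < i)%N then spin0 else if (i < j)%N then spin1 else spinf)
    then expR (- y / 2) ^+ (2 * minn i j) else 0).
Proof.
rewrite big_mkcond; apply: eq_bigr => b _.
rewrite /dotW /dotSP_weight /dotphi; case: (P _); last by rewrite mul0r.
congr (_ * _); rewrite -expRM_natl; congr expR.
by rewrite natrM; lra.
Qed.

(** The update acts on the single number [q spinf], because [dotW] returns [spinf]
    exactly on the ties. *)
Lemma SP_tie k d y q : (1 < k)%N -> 0 <= y -> calM q ->
  let p := (force_poly k).[q spinf] in let s := expR (- y / 2) in
  0 <= p <= 8^-1 ->
  calM (SP k d y q) /\
  SP k d y q spinf = (tie_poly s d.-1).[p] / (total_poly s d.-1).[p].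
Proof.
move=> k1 y0 qM p s /andP[p0 p8]; have [h0 h1 hf] := hatSPE k1 qM.
set qh := hatSP k q in h0 h1 hf *.
have r0 : 0 <= 1 - 2 * p by move: p0 p8; lra.
have s0 : 0 <= s by exact: expR_ge0.
have s1 : s <= 1 by rewrite -expR0 ler_expR; lra.
pose F i j : R := s ^+ (2 * minn i j).
have Zgt0 := @total_gt0 _ _ _ s0 s1 p0 p8 d.-1.
have zE : \sum_(b : {ffun 'I_d.-1 -> spin}) dotSP_weight y qh b = (total_poly s d.-1).[p].
  by rewrite (dotSP_weight_sum _ _ _ xpredT) -(spin_sum_total s h0 h1 hf).
have dotE u : SP k d y q u = (total_poly s d.-1).[p]^-1 *
    \sum_(b : {ffun 'I_d.-1 -> spin} | u == dotW b) dotSP_weight y qh b.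
  by rewrite /SP ffunE zE.
have fE : SP k d y q spinf = (tie_poly s d.-1).[p] / (total_poly s d.-1).[p].
  rewrite dotE mulrC (dotSP_weight_sum _ _ _ (fun u => spinf == u)); congr (_ / _).
  rewrite -(spin_sum_tie s h0 h1 hf); apply: eq_spin_sum => i j.
  by case: (ltngtP i j).
split=> //; split.
- move=> u; rewrite dotE mulr_ge0 ?invr_ge0 ?(ltW Zgt0) //.
  apply: sumr_ge0 => b _; rewrite mulr_ge0 ?expR_ge0 //.
  by apply: prodr_ge0 => i _; case: (b i) => [[]|]; rewrite ?h0 ?h1 ?hf //.
- rewrite (eq_bigr _ (fun u _ => dotE u)) -mulr_sumr.
  have -> : \sum_u \sum_(b : {ffun 'I_d.-1 -> spin} | u == dotW b) dotSP_weight y qh b =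
      \sum_(b : {ffun 'I_d.-1 -> spin}) dotSP_weight y qh b.
    rewrite [RHS](partition_big (@dotW d.-1) xpredT) //=; apply: eq_bigr => u _.
    by apply: eq_bigl => b; rewrite eq_sym.
  by rewrite zE mulVf // gt_eqF.
- rewrite !dotE; congr (_ * _).
  rewrite (dotSP_weight_sum _ _ _ (fun u => spin0 == u)).
  rewrite (dotSP_weight_sum _ _ _ (fun u => spin1 == u)).
  rewrite spin_sum_swap ?h0 ?h1 //; apply: eq_spin_sum => i j.
  by rewrite minnC; case: (ltngtP i j).
Qed.

End Reduction.

(** * The scalar fixed-point equation *)

Section ScalarBounds.
Variables (R : realType) (s p : R).
Hypotheses (s0 : 0 <= s) (s1 : s <= 1) (p0 : 0 <= p) (p8 : p <= 8^-1).

Local Notation L := (1 - 2 * p * (1 - s)).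
Local Notation D := (1 - p * (1 - s ^+ 2)).
Local Notation g n := (n%:R * (p * (1 - s) ^+ 2)).

(** [L / D = 1 - z / D <= 1 - z <= expR (- z)] for [z = D - L = p * (1 - s) ^+ 2]. *)
Lemma ratio_le n : L ^+ n <= expR (- g n) * D ^+ n.
Proof.
have [L0 L1 D0 D1] := LD_bounds s0 s1 p0 p8.
have z0 : 0 <= p * (1 - s) ^+ 2 by rewrite mulr_ge0 ?sqr_ge0.
rewrite -[- g n]mulrN expRM_natl -exprMn; apply: lerXn2r; rewrite ?nnegrE.
- by move: L0; lra.
- by rewrite mulr_ge0 ?expR_ge0 //; move: D0; lra.
have Dge0 : 0 <= D by move: D0; lra.
apply: le_trans (ler_wpM2r Dge0 (expR_ge1Dx _)).
have -> : L = D - p * (1 - s) ^+ 2 by ring.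
rewrite [leRHS]mulrDl mul1r mulNr lerD2l lerN2 ler_piMr //.
Qed.

(** [D / L = 1 + z / L <= expR (z / L)], and [1 / L <= 1 + 4 p]. *)
Lemma ratio_ge n : D ^+ n <= expR (g n * (1 + 4 * p)) * L ^+ n.
Proof.
have [L0 L1 D0 D1] := LD_bounds s0 s1 p0 p8.
have z0 : 0 <= p * (1 - s) ^+ 2 by rewrite mulr_ge0 ?sqr_ge0.
rewrite -[g n * _]mulrA expRM_natl -exprMn; apply: lerXn2r; rewrite ?nnegrE.
- by move: D0; lra.
- by rewrite mulr_ge0 ?expR_ge0 //; move: L0; lra.
have Lge0 : 0 <= L by move: L0; lra.
apply: le_trans (ler_wpM2r Lge0 (expR_ge1Dx _)).
have -> : D = L + p * (1 - s) ^+ 2 by ring.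
rewrite [leRHS]mulrDl mul1r lerD2l -[leRHS]mulrA -[leLHS]mulr1 ler_wpM2l //.
have ps0 : 0 <= p * s by exact: mulr_ge0.
have : 1 - 2 * p <= L by move: ps0; lra.
have p4 : 0 <= 1 + 4 * p by move: p0; lra.
move=> /(ler_wpM2l p4); apply: le_trans.
have : 0 <= p * (8^-1 - p) by rewrite mulr_ge0 // subr_ge0.
by move: p0; nra.
Qed.

(** When [s] is small, [1 - s] is comparable to [(1 - s) ^+ 2]; otherwise the
    square-root decay of the ties, relative to [L ^+ n], compensates for the
    missing factor. *)
Lemma tie_drift_le n :
  n.+1%:R * p * (1 - s) * (tie_poly s n).[p] <= (1 + 2 * g n.+1) * L ^+ n.
Proof.
have w0 := tie_ge0 s0 s1 p0 p8 n; have wE := tie_le s0 s1 p0 p8 n.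
have := tie_sqr_le s0 s1 p0 p8 n.
have v0 : 0 <= n.+1%:R * p :> R by rewrite mulr_ge0.
rewrite [n.+1%:R * (p * _)]mulrA.
have -> : 4 * n.+1%:R * (p * s) = 4 * (n.+1%:R * p) * s by rewrite !mulrA.
move: w0 wE v0; set w := (tie_poly s n).[p]; set E := L ^+ n; set v := n.+1%:R * p.
move=> w0 wE v0 sq; have E0 : 0 <= E by exact: le_trans wE.
have t0 : 0 <= 1 - s by rewrite subr_ge0.
have [shalf|shalf] := leP s (2^-1).
  have vE : v * (1 - s) * w <= v * (1 - s) * E by rewrite ler_wpM2l ?mulr_ge0.
  have : 0 <= v * (1 - s) * E by rewrite !mulr_ge0.
  have : 0 <= v * (1 - s) * E * (2^-1 - s) by rewrite !mulr_ge0 // subr_ge0.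
  by move: vE; nra.
have gE : 0 <= v * (1 - s) ^+ 2 by rewrite mulr_ge0 ?sqr_ge0.
have R0 : 0 <= (1 + 2 * (v * (1 - s) ^+ 2)) * E.
  by rewrite mulr_ge0 // addr_ge0 // mulr_ge0.
rewrite -(@ler_pXn2r _ 2) ?nnegrE // ?mulr_ge0 //.
have half : 2 * (v * w ^+ 2) <= E ^+ 2.
  apply: le_trans sq; have : 0 <= v * w ^+ 2 * (s - 2^-1).
    by rewrite !mulr_ge0 ?sqr_ge0 // subr_ge0 ltW.
  by nra.
have h1 := ler_wpM2l gE half; have E2 : 0 <= E ^+ 2 by exact: sqr_ge0.
have h2 := mulr_ge0 gE E2; have h3 := mulr_ge0 gE h2.
have -> : (v * (1 - s) * w) ^+ 2 = v * (1 - s) ^+ 2 * (v * w ^+ 2) by ring.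
rewrite exprMn.
set G := v * (1 - s) ^+ 2 in gE h1 h2 h3 *.
have -> : (1 + 2 * G) ^+ 2 * E ^+ 2 = E ^+ 2 + 4 * (G * E ^+ 2) + 4 * (G * (G * E ^+ 2)) by ring.
by move: h1 h2 h3 E2; lra.
Qed.

End ScalarBounds.

Section Gap.
Variables (R : realType) (k n : nat) (s : R).
Hypotheses (s0 : 0 <= s) (s1 : s <= 1).

(** Clearing the denominator makes the fixed-point equation polynomial in [x], within
    reach of the intermediate and mean value theorems for polynomials. *)
Definition gap_poly : {poly R} :=
  'X * (total_poly s n \Po force_poly R k) - (tie_poly s n \Po force_poly R k).

Lemma gap_polyE (x : R) : let p := (force_poly R k).[x] in
  gap_poly.[x] = x * (total_poly s n).[p] - (tie_poly s n).[p].
Proof. by move=> p; rewrite /gap_poly hornerD hornerN hornerM hornerX !horner_comp. Qed.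

Lemma deriv_force (x : R) : (1 < k)%N ->
  (1 - x) * (force_poly R k)^`().[x] = - (k.-1%:R * (force_poly R k).[x]).
Proof.
rewrite force_polyE /force_poly => k1.
rewrite deriv_exp derivZ derivB derivX -polyC1 derivC.
rewrite hornerMn !hornerE /= -(@prednK k.-1); last by case: k k1 => [|[]].
by rewrite /= [(1 - x) / 2]mulrC [in RHS]exprS -[_ *+ _]mulr_natl; ring.
Qed.

(** The derivative of [gap_poly] is the total weight, plus a nonnegative term
    because both the total weight and the clause force decrease, minus the
    derivative of the ties, which is smaller by the exponential factor separating
    [L ^+ n] from [D ^+ n]. *)
Lemma deriv_gap_gt0 (x : R) : (1 < k)%N -> (0 < n)%N -> 0 <= x -> x <= 2^-1 ->
  let p := (force_poly R k).[x] in let g := n%:R * (p * (1 - s) ^+ 2) in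
  p <= 8^-1 -> 18 * k%:R * (1 + g) * expR (- g) < 1 -> 0 < gap_poly^`().[x].
Proof.
move=> k1 n1 x0 xh p g p8 small.
have p0 : 0 <= p by rewrite /p force_polyE exprn_ge0 //; lra.
have [L0 L1 D0 D1] := LD_bounds s0 s1 p0 p8.
have bd := deriv_tie_bound s0 s1 p0 p8 n.-1; rewrite prednK // in bd.
have drift := tie_drift_le s0 s1 p0 p8 n.-1; rewrite prednK // -/g in drift.
have ratio := ratio_le s0 s1 p0 p8 n; rewrite -/g in ratio.
have Zge := total_ge s0 s1 p0 p8 n.
have Z'le := deriv_total_le0 s0 s1 p0 p8 n.
have dP := deriv_force x k1; rewrite -/p in dP.
have g0 : 0 <= g by rewrite mulr_ge0 // mulr_ge0 // sqr_ge0.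
have kk : k.-1%:R <= k%:R :> R by rewrite ler_nat leq_pred.
have k'0 : 0 <= k.-1%:R :> R by [].
have -> : gap_poly^`().[x] = (total_poly s n).[p] +
    (x * (total_poly s n)^`().[p] - (tie_poly s n)^`().[p]) * (force_poly R k)^`().[x].
  rewrite /gap_poly derivB derivM derivX !deriv_comp mul1r.
  rewrite !hornerD hornerN !hornerM hornerX !horner_comp -/p.
  by ring.
have x1 : 0 < 1 - x by lra.
rewrite -(pmulr_rgt0 _ x1).
set Z := (total_poly s n).[p] in Zge *; set Z' := (_^`()).[p] in Z'le *.
set N' := (tie_poly s n)^`().[p] in bd *; set P' := (force_poly R k)^`().[x] in dP *.
have -> : (1 - x) * (Z + (x * Z' - N') * P') =
    (1 - x) * Z + (x * Z' - N') * ((1 - x) * P') by ring.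
rewrite dP.
set L := 1 - 2 * p * (1 - s) in L0 L1 drift bd ratio *.
set D := 1 - p * (1 - s ^+ 2) in D0 D1 ratio Zge *.
have Dn : 0 < D ^+ n by rewrite exprn_gt0 //; lra.
have Ln1 : 0 <= L ^+ n.-1 by rewrite exprn_ge0 //; lra.
have LnE : L ^+ n = L * L ^+ n.-1 by rewrite -exprS prednK.
have L2 : L ^+ n.-1 <= 2 * L ^+ n.
  by rewrite LnE mulrA -[leLHS]mul1r ler_wpM2r //; lra.
have Ln : 0 <= L ^+ n by rewrite exprn_ge0 //; lra.
have N'le : - (p * N') <= 9 * (1 + g) * L ^+ n.
  have gp : 0 <= 1 + 2 * g by rewrite addr_ge0 // mulr_ge0.
  move: Ln bd drift (mulr_ge0 g0 Ln) (ler_wpM2l gp L2).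
  by clearbody L D N' g; lra.
have ZD : 2^-1 * D ^+ n <= (1 - x) * Z by nra.
have term1 : 0 <= - (x * Z' * (k.-1%:R * p)).
  by rewrite oppr_ge0 mulr_le0_ge0 ?mulr_ge0 // mulr_ge0_le0.
have term2 : k.-1%:R * - (p * N') <= k%:R * (9 * (1 + g) * L ^+ n).
  apply: le_trans (ler_wpM2l k'0 N'le) _; rewrite ler_wpM2r // !mulr_ge0 //; lra.
have final : k%:R * (9 * (1 + g) * L ^+ n) < 2^-1 * D ^+ n.
  apply: le_lt_trans (_ : k%:R * (9 * (1 + g) * (expR (- g) * D ^+ n)) < _).
    by rewrite ler_wpM2l // ler_wpM2l // mulr_ge0 //; lra.
  have := small; rewrite -(ltr_pM2r Dn) mul1r; lra.
lra.
Qed.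

End Gap.

(** * Asymptotic regime *)

Section Regime.
Variable R : realType.

Lemma ln2_bounds : (2^-1 : R) <= ln 2 /\ (ln 2 : R) <= 1.
Proof.
have ln2K : expR (ln (2 : R)) = 2 by rewrite lnK // posrE.
split; rewrite -ler_expR ln2K; last first.
  by apply: le_trans (expR_ge1Dx _); lra.
have : 2^-1 <= expR (- 2^-1) :> R by apply: le_trans (expR_ge1Dx _); lra.
by rewrite expRN lef_pV2 ?posrE ?expR_gt0.
Qed.

Lemma powR2E (t : R) : (2 : R) `^ t = expR (t * ln 2).
Proof. by rewrite /powR pnatr_eq0. Qed.

Lemma bernoulli_ineq (x : R) m : 0 <= x <= 1 -> 1 - m%:R * x <= (1 - x) ^+ m.
Proof.
case/andP=> x0 x1; elim: m => [|m IH]; first by rewrite mul0r subr0 expr0.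
have x2 : 0 <= 1 - x by lra.
rewrite exprS -natr1; have := ler_wpM2l x2 IH.
have : 0 <= m%:R * x * x by rewrite !mulr_ge0.
by move=> ? ?; nra.
Qed.

(** By Bernoulli's inequality, [(1 - x) ^+ k.-1 >= 1 - k.-1 / k^2]. *)
Lemma force_bounds k (x : R) : (4 <= k)%N -> 0 <= x <= 1 / k%:R ^+ 2 ->
  let p := (force_poly R k).[x] in
  [/\ 2 ^- k.-1 * (1 - k%:R^-1) <= p, p <= 2 ^- k.-1 & p <= 8^-1].
Proof.
move=> k4 /andP[x0 xk] p.
have k0 : 0 < k%:R :> R by rewrite ltr0n; case: k k4 {xk p}.
have k1 : 1 <= k%:R :> R by rewrite ler1n; case: k k4 {xk p k0}.
have kx : k%:R * x <= k%:R^-1.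
  have := ler_wpM2l (ltW k0) xk; rewrite expr2 mul1r invfM mulrA divff ?gt_eqF //.
  by rewrite mul1r.
have x1 : x <= 1.
  apply: le_trans xk _; rewrite mul1r invf_le1 ?exprn_gt0 //.
  by rewrite exprn_ege1.
have pE : p = 2 ^- k.-1 * (1 - x) ^+ k.-1.
  by rewrite /p force_polyE exprMn exprVn mulrC.
have e0 : 0 < 2 ^- k.-1 :> R by rewrite invr_gt0 exprn_gt0.
have ple : p <= 2 ^- k.-1.
  rewrite pE ler_piMr ?(ltW e0) //; apply: exprn_ile1; lra.
split=> //.
  rewrite pE ler_wpM2l ?(ltW e0) //.
  apply: le_trans (_ : 1 - k.-1%:R * x <= _); last by apply: bernoulli_ineq; rewrite x0.
  rewrite lerD2l lerN2; apply: le_trans kx; rewrite ler_wpM2r // ler_nat.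
  exact: leq_pred.
apply: le_trans ple _; have -> : 8 = 2 ^+ 3 :> R by rewrite !exprS expr0; ring.
rewrite lef_pV2 ?posrE ?exprn_gt0 // ler_weXn2l ?ler1n //.
by rewrite -ltnS (ltn_predK k4).
Qed.

Lemma nat_le_exp2 k : (0 < k)%N -> k%:R <= 2 ^+ k.-1 :> R.
Proof.
case: k => // k _ /=; rewrite -natrX ler_nat.
by elim: k => // k IH; rewrite expnS mul2n -addnn -addn1 leq_add // expn_gt0.
Qed.

(** The constant [48] comes from [expR (g / 2) >= (g / 2) ^+ 3 / 3!], and [37] exceeds
    the [18 * 2] needed in the first conclusion. *)
Lemma exp_beats_poly (e : R) (k : nat) (g : R) : 0 < e ->
  37 <= k%:R * (e ^+ 3 / 48) -> k%:R * e <= g ->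
  18 * k%:R * (1 + g) * expR (- g) < 1 /\ expR (- g) <= 1 / k%:R ^+ 2.
Proof.
move=> e0 ke kg.
have e3 : 0 < e ^+ 3 / 48 by rewrite divr_gt0 ?exprn_gt0.
have k0 : 0 < k%:R :> R by rewrite -(pmulr_lgt0 _ e3); lra.
have k1 : 1 <= k%:R :> R by rewrite ler1n; move: k0; rewrite ltr0n.
have ke0 : 0 <= k%:R * e by rewrite mulr_ge0 // ltW.
have g0 : 0 <= g by lra.
set G := expR (g / 2).
have G0 : 0 < G by exact: expR_gt0.
have GG : expR (- g) = G^-1 * G^-1 by rewrite -expRN -expRD; congr expR; lra.
have G1 : 1 + g / 2 <= G by exact: expR_ge1Dx.
have G1' : 1 <= G by lra.
have G3 : 37 * k%:R ^+ 2 <= G.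
  have := @expR_ge1Dxn R (g / 2) 2 (divr_ge0 g0 (ler0n R 2)).
  rewrite -/G => h.
  have cube : (k%:R * e) ^+ 3 <= g ^+ 3 by rewrite lerXn2r ?nnegrE.
  have k2 : 0 <= k%:R ^+ 2 :> R by rewrite exprn_ge0.
  have := ler_wpM2r k2 ke.
  have -> : k%:R * (e ^+ 3 / 48) * k%:R ^+ 2 = (k%:R * e) ^+ 3 / 48 by ring.
  move: h; have -> : 3`!%:R = 6 :> R by [].
  have -> : (g / 2) ^+ 3 / 6 = g ^+ 3 / 48 by field.
  by move: cube; lra.
have k2 : k%:R <= k%:R ^+ 2 :> R by rewrite expr2 ler_peMl // ltW.
have Gi : 0 < G^-1 by rewrite invr_gt0.
split.
  rewrite GG mulrA.
  have s1 : (1 + g) * G^-1 <= 2 by rewrite ler_pdivrMr //; lra.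
  rewrite -[_ * (1 + g) * _]mulrA.
  apply: le_lt_trans (_ : 18 * k%:R * 2 * G^-1 < 1).
    by rewrite ler_wpM2r ?(ltW Gi) // ler_wpM2l // mulr_ge0 // ltW.
  by rewrite ltr_pdivrMr // mul1r; lra.
rewrite GG mul1r -invfM lef_pV2 ?posrE ?mulr_gt0 ?exprn_gt0 //.
apply: le_trans (_ : G <= _); first by lra.
by rewrite ler_peMr // ltW.
Qed.

End Regime.

(** * Size and uniqueness of the fixed point *)

Section FixedPoint.
Variable R : realType.

Section TieRatio.
Variables (s p m : R) (n : nat).
Hypotheses (s0 : 0 <= s) (s1 : s <= 1) (p0 : 0 <= p) (p8 : p <= 8^-1) (m1 : 1 <= m).

Local Notation g := (n%:R * (p * (1 - s) ^+ 2)).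
Local Notation ratio := ((tie_poly s n).[p] / (total_poly s n).[p]).

(** [tie_sqr_le] and [tie_le] bound the ties, [total_ge] the total. *)
Lemma tie_ratio_le : m <= Num.max (4 * n.+1%:R * (p * s)) 1 ->
  ratio <= expR (- g) / Num.sqrt m.
Proof.
move=> mle; have m0 : 0 <= m by apply: le_trans m1.
have sm : 0 < Num.sqrt m by rewrite sqrtr_gt0; apply: lt_le_trans m1.
have N0 := tie_ge0 s0 s1 p0 p8 n; have Nle := tie_le s0 s1 p0 p8 n.
have Ln := le_trans N0 Nle.
have Nm : (tie_poly s n).[p] <= (1 - 2 * p * (1 - s)) ^+ n / Num.sqrt m.
  rewrite ler_pdivlMr // -(@ler_pXn2r _ 2) ?nnegrE ?mulr_ge0 ?sqrtr_ge0 //.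
  rewrite exprMn sqr_sqrtr //; apply: le_trans (ler_wpM2l (sqr_ge0 _) mle) _.
  rewrite maxr_pMr ?sqr_ge0 // ge_max (tie_sqr_le s0 s1 p0 p8) mulr1 andTb.
  by rewrite lerXn2r ?nnegrE.
have Z0 := total_gt0 s0 s1 p0 p8 n.
rewrite ler_pdivrMr //; apply: le_trans Nm _; rewrite ler_pdivrMr //.
rewrite [leRHS]mulrAC divfK ?gt_eqF //.
apply: le_trans (ratio_le s0 s1 p0 p8 n) _.
by rewrite ler_wpM2l ?expR_ge0 // total_ge.
Qed.

(** The loss [12] is [2] from [total_le], [2] from [tie_lower] and [3] from
    [sqrt (9 * m)]. *)
Lemma tie_ratio_ge : 1 + 8 * n%:R * (p * s) <= 9 * m ->
  expR (- (g * (1 + 4 * p))) / (12 * Num.sqrt m) <= ratio.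
Proof.
move=> mge; have m0 : 0 < m by apply: lt_le_trans m1.
have sm : 0 < Num.sqrt m by rewrite sqrtr_gt0.
set mu := 1 + 8 * n%:R * (p * s) in mge.
have mu0 : 0 < mu by rewrite ltr_pwDl // !mulr_ge0.
have smu : 0 < Num.sqrt mu by rewrite sqrtr_gt0.
have smu_le : Num.sqrt mu <= 3 * Num.sqrt m.
  have -> : 3 = Num.sqrt (3 ^+ 2) :> R by rewrite sqrtr_sqr ger0_norm.
  rewrite -sqrtrM ?sqr_ge0 // ler_wsqrtr //; lra.
have low : (Num.sqrt mu)^-1 * (1 - 2 * p * (1 - s)) ^+ n <= 2 * (tie_poly s n).[p].
  apply: tie_lower => //.
  by rewrite exprVn sqr_sqrtr ?(ltW mu0) // mulVf // gt_eqF.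
have [L0 L1 _ _] := LD_bounds s0 s1 p0 p8.
have Ln : 0 <= (1 - 2 * p * (1 - s)) ^+ n by rewrite exprn_ge0 //; move: L0; lra.
have Z0 := total_gt0 s0 s1 p0 p8 n.
pose q : {ffun spin -> R} := [ffun h => if h is Some _ then p else 1 - 2 * p].
have Zle : (total_poly s n).[p] <= 2 * (1 - p * (1 - s ^+ 2)) ^+ n.
  apply: (@total_le _ q); rewrite ?ffunE // => -[?|]; rewrite ffunE //.
  by move: p0 p8; lra.
have DL := ratio_ge s0 s1 p0 p8 n.
set e := g * (1 + 4 * p) in DL *.
set L := (_ ^+ n) in low Ln DL; set D := (_ ^+ n) in Zle DL.
set Z := (total_poly s n).[p] in Z0 Zle *; set N := (tie_poly s n).[p] in low *.
rewrite ler_pdivrMr ?mulr_gt0 // mulrAC ler_pdivlMr // expRN.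
rewrite ler_pdivrMl ?expR_gt0 //; apply: le_trans Zle _.
apply: le_trans (ler_wpM2l (ler0n R 2) DL) _.
have LN : L <= 2 * N * (3 * Num.sqrt m).
  apply: le_trans (_ : 2 * N * Num.sqrt mu <= _); last first.
    rewrite ler_wpM2l //; apply: le_trans low; rewrite mulr_ge0 ?invr_ge0 ?sqrtr_ge0 //.
  by rewrite -ler_pdivrMr // mulrC.
have := ler_wpM2l (expR_ge0 e) LN; lra.
Qed.

End TieRatio.

(** One unknown suffices because [SP] maps into [calM], where a measure is determined
    by its value at [spinf]. *)
Lemma SP_fixedE k d (y : R) q : (4 <= k)%N -> 0 <= y -> calM_bullet k q ->
  q = SP k d y q <-> (gap_poly k d.-1 (expR (- y / 2))).[q spinf] = 0.
Proof.
move=> k4 y0 [qM qk]; have k1 : (1 < k)%N by apply: leq_trans k4.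
have x0 : 0 <= q spinf by case: qM => + _ _; apply.
have [|_ _ p8] := force_bounds k4 (x := q spinf); first by rewrite x0.
have p0 : 0 <= (force_poly R k).[q spinf].
  rewrite force_polyE exprn_ge0 // divr_ge0 // subr_ge0.
  by case: qM => pos; rewrite sum_spin => sum1 _;
     have := pos spin0; have := pos spin1; lra.
have [|SPM SPf] := @SP_tie _ k d y q k1 y0 qM; first by rewrite p0.
have s0 : 0 <= expR (- y / 2) by exact: expR_ge0.
have s1 : expR (- y / 2) <= 1 by rewrite -expR0 ler_expR mulNr oppr_le0 divr_ge0.
have Z0 := total_gt0 s0 s1 p0 p8 d.-1.
rewrite gap_polyE; split=> [qE|/eqP].
  by rewrite {1}qE SPf divfK ?gt_eqF // subrr.
rewrite subr_eq0 => /eqP xE; apply: (calM_ext qM SPM).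
by rewrite SPf -xE mulfK // gt_eqF.
Qed.

(** Existence by the intermediate value theorem, the ties being a fraction at most
    [expR (- g) <= 1 / k ^+ 2] of the total; uniqueness by monotonicity. *)
Lemma gap_root k n (s e : R) : (4 <= k)%N -> (0 < n)%N -> 0 <= s -> s <= 1 ->
  0 < e -> 37 <= k%:R * (e ^+ 3 / 48) ->
  (forall x, 0 <= x <= 1 / k%:R ^+ 2 ->
     k%:R * e <= n%:R * ((force_poly R k).[x] * (1 - s) ^+ 2)) ->
  exists2 x, 0 <= x <= 1 / k%:R ^+ 2 /\ (gap_poly k n s).[x] = 0 &
    forall x', 0 <= x' <= 1 / k%:R ^+ 2 -> (gap_poly k n s).[x'] = 0 -> x' = x.
Proof.
move=> k4 n0 s0 s1 e0 ke lowg; set b := 1 / k%:R ^+ 2.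
have k0 : 0 < k%:R :> R by rewrite ltr0n (leq_trans _ k4).
have k4R : 4 <= k%:R :> R by rewrite (ler_nat R 4).
have b0 : 0 < b by rewrite divr_gt0 ?exprn_gt0.
have bh : b <= 2^-1.
  by rewrite /b mul1r lef_pV2 ?posrE ?exprn_gt0 // expr2; nra.
have pP x : 0 <= x <= b -> 0 <= (force_poly R k).[x] <= 8^-1.
  move=> xb; have [_ _ ->] := force_bounds k4 xb; rewrite andbT force_polyE.
  by apply: exprn_ge0; rewrite divr_ge0 // subr_ge0; case/andP: xb; lra.
have small x : 0 <= x <= b -> _ := fun xb => exp_beats_poly e0 ke (lowg x xb).
have der x : x \in `]0, b[ -> 0 < (gap_poly k n s)^`().[x].
  rewrite in_itv /= => /andP[x0 xb].
  have xb' : 0 <= x <= b by rewrite !ltW.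
  have [_ p8] := andP (pP x xb'); have [sm _] := small x xb'.
  apply: deriv_gap_gt0 => //; [exact: leq_trans k4|exact: ltW|].
  by apply: le_trans bh; exact: ltW.
have inj := derp_inj der.
have [x xb xroot] : exists2 x, 0 <= x <= b & root (gap_poly k n s) x.
  apply: Num.Theory.poly_ivt; first exact: ltW.
  have end0 : 0 <= (0 : R) <= b by rewrite lexx (ltW b0).
  have endb : 0 <= b <= b by rewrite lexx (ltW b0).
  have [p0 p8] := andP (pP 0 end0); have [p0' p8'] := andP (pP b endb).
  apply/andP; split; rewrite gap_polyE.
    by rewrite mul0r sub0r oppr_le0 tie_ge0.
  rewrite subr_ge0; apply: le_trans (tie_le s0 s1 p0' p8' n) _.
  apply: le_trans (ratio_le s0 s1 p0' p8' n) _.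
  have [_ eb] := small b endb.
  apply: le_trans (ler_wpM2r _ eb) _; last by rewrite ler_wpM2l ?(ltW b0) // total_ge.
  by have [_ _ D0 _] := LD_bounds s0 s1 p0' p8'; rewrite exprn_ge0 //; move: D0; lra.
exists x => [|x' xb' x'root]; first by split=> //; apply/rootP.
by apply: inj; rewrite ?in_itv //= x'root (rootP xroot).
Qed.

End FixedPoint.

(** Of the relative error [2 / k], one half comes from [d.-1 < d] and the other from
    [q spinf > 0], through [force_bounds]. The case of interest is
    [lam = k c ln 2]. *)
Lemma messages_force_bounds (R : realType) (k d : nat) (lam p : R) :
  (0 < k)%N -> (k <= d)%N -> d%:R = lam * 2 ^+ k.-1 -> 0 <= p ->
  2 ^- k.-1 * (1 - k%:R^-1) <= p -> p <= 2 ^- k.-1 ->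
  lam * (1 - 2 / k%:R) <= d.-1%:R * p /\ d.-1%:R * p <= lam.
Proof.
move=> k0 kd dE p0 plow pup.
have d0 : (0 < d)%N by exact: leq_trans kd.
have nE : d.-1%:R = d%:R - 1 :> R by rewrite -[in RHS](prednK d0) -natr1 addrK.
have E0 : 0 < 2 ^- k.-1 :> R by rewrite invr_gt0 exprn_gt0.
have lamE : lam = d%:R * 2 ^- k.-1 by rewrite dE mulfK // gt_eqF // exprn_gt0.
have kR : 0 < k%:R :> R by rewrite ltr0n.
have k1 : k%:R^-1 <= 1 :> R by rewrite invf_le1 // ler1n.
have dk : 1 <= d%:R * k%:R^-1 :> R by rewrite ler_pdivlMr // mul1r ler_nat.
have n0 : 0 <= d.-1%:R :> R by [].
split.
  apply: le_trans (ler_wpM2l n0 plow); rewrite nE lamE.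
  set w := k%:R^-1 in k1 dk *; set E := 2 ^- k.-1 in E0 *.
  have w0 : 0 <= w by rewrite invr_ge0.
  rewrite -subr_ge0.
  have -> : (d%:R - 1) * (E * (1 - w)) - d%:R * E * (1 - 2 * w) =
    E * (d%:R * w - 1 + w) by ring.
  by apply: mulr_ge0; [exact: ltW | lra].
apply: le_trans (ler_wpM2l n0 pup) _; rewrite lamE ler_wpM2r ?(ltW E0) //.
by rewrite ler_nat leq_pred.
Qed.

(** All the losses are bounded factors: [g] differs from its ideal value by the
    relative error [2 / k], that is by [C] at most; [n * p * s] is within a factor
    [4] of [c k s]; and the ratio lemmas lose at most [12]. *)
Lemma tie_ratio_scale (R : realType) (k n : nat) (s p c C : R) :
  0 <= s -> s <= 1 -> 0 <= p -> p <= 8^-1 -> 4 <= k%:R :> R -> 0 <= c ->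
  p <= k%:R^-1 ->
  let lam := k%:R * c * ln 2 in let g0 := lam * (1 - s) ^+ 2 in
  lam * (1 - 2 / k%:R) <= n%:R * p /\ n%:R * p <= lam ->
  g0 * (2 / k%:R) <= C ->
  let ratio := (tie_poly s n).[p] / (total_poly s n).[p] in
  let scale := expR (- g0) / Num.sqrt (Num.max (c * k%:R * s) 1) in
  (12 * expR (2 * C))^-1 * scale <= ratio /\ ratio <= 12 * expR (2 * C) * scale.
Proof.
move=> s0 s1 p0 p8 k4R c0 pk lam g0 [nplow npup] g0up ratio.
have [l2 l2'] := ln2_bounds R.
set m := Num.max _ _.
have kci : 0 <= k%:R * c by rewrite mulr_ge0.
have lam0 : 0 <= lam by apply: mulr_ge0 => //; lra.
have lamkc : lam <= k%:R * c by rewrite /lam ler_piMr.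
have lamkc2 : k%:R * c <= 2 * lam by have := ler_wpM2l kci l2; rewrite /lam; lra.
have k2 : 2 / k%:R <= 2^-1 :> R by rewrite ler_pdivrMr //; lra.
have tt0 : 0 <= (1 - s) ^+ 2 by exact: sqr_ge0.
have g00 : 0 <= g0 by rewrite mulr_ge0.
have C0 : 0 <= C by apply: le_trans g0up; rewrite mulr_ge0 // divr_ge0.
have m1 : 1 <= m by rewrite le_max lexx orbT.
have mc : c * k%:R * s <= m by rewrite le_max lexx.
have m0 : 0 < Num.sqrt m by rewrite sqrtr_gt0 (lt_le_trans ltr01 m1).
set tt := (1 - s) ^+ 2 in tt0 g0 g0up g00 *.
set g := n%:R * (p * tt).
have gE : g = n%:R * p * tt by rewrite /g mulrA.
have gup0 : g <= g0 by rewrite gE /g0 ler_wpM2r.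
have glow0 : g0 - C <= g.
  have := ler_wpM2r tt0 nplow; rewrite -gE.
  have -> : lam * (1 - 2 / k%:R) * tt = g0 - g0 * (2 / k%:R) by rewrite /g0; ring.
  by move: g0up; clear; lra.
have gp : g * (4 * p) <= 2 * C.
  apply: le_trans (_ : g0 * (4 * k%:R^-1) <= _).
    have g_ge0 : 0 <= g := mulr_ge0 (ler0n R _) (mulr_ge0 p0 tt0).
    have p4 : 0 <= 4 * p by apply: mulr_ge0.
    by apply: ler_pM => //; rewrite ler_wpM2l.
  by move: g0up; clear; lra.
have up : ratio <= expR (- g) / Num.sqrt m.
  apply: tie_ratio_le => //.
  rewrite /m ge_max !le_max lexx orbT andbT; apply/orP; left.
  have ns : lam * s <= 2 * (n%:R * p) * s.
    rewrite ler_wpM2r //; apply: (@le_trans _ _ (2 * (lam * (1 - 2 / k%:R)))).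
      by have := ler_wpM2l lam0 k2; lra.
    by rewrite ler_wpM2l.
  have := ler_wpM2r s0 lamkc2; have := mulr_ge0 p0 s0.
  by move: ns; rewrite -[_.+1%:R]natr1; clear; lra.
have low : expR (- (g * (1 + 4 * p))) / (12 * Num.sqrt m) <= ratio.
  apply: tie_ratio_ge => //.
  have := ler_wpM2r s0 npup; have := ler_wpM2r s0 lamkc.
  by move: mc m1; clear; lra.
split.
  apply: le_trans low.
  rewrite !invfM mulrA [leRHS]mulrA ler_wpM2r ?invr_ge0 ?(ltW m0) //.
  rewrite -mulrA [leLHS]mulrC -expRN ler_wpM2r // -expRD ler_expR.
  by move: gp gup0; clear; lra.
apply: le_trans up _.
rewrite mulrA ler_wpM2r ?invr_ge0 ?(ltW m0) //.
apply: le_trans (_ : expR (2 * C) * expR (- g0) <= _).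
  by rewrite -expRD ler_expR; move: glow0 C0; clear; lra.
by rewrite ler_wpM2r ?expR_ge0 // ler_peMl ?expR_ge0 // ler1n.
Qed.

Theorem proposition1p7 (R : realType) (c0 C0 : R) (hc0 : 0 < c0) (hC0 : c0 < C0) :
  exists (k0 : nat) (K : R), 1 <= K /\
    forall k : nat, (k0 <= k)%N ->
    forall asat : R, is_sat_threshold k asat ->
    forall (d : nat) (alpha c : R),
      alpha = d%:R / k%:R ->
      alpha = c * 2 ^+ k.-1 * ln 2 ->
      asat <= alpha ->
      alpha <= 4 ^+ k / k%:R ->
    forall y : R, 0 <= y ->
      c0 <= gamma c y -> gamma c y <= C0 ->
    exists q : {ffun spin -> R},
      unique (fun q' => calM_bullet k q' /\ q' = SP k d y q') q /\
      calM_gamma K k c y q.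
Proof.
have [l2 l2'] := ln2_bounds R.
have C00 : 0 < C0 by exact: lt_trans hC0.
(* [g] is at least half of [k gamma ln 2 / 2], hence at least [k * (c0 / 8)] *)
pose e := c0 / 8; have e0 : 0 < e by rewrite divr_gt0.
have e3 : 0 < e ^+ 3 / 48 by rewrite divr_gt0 ?exprn_gt0.
pose K := 12 * expR (2 * C0).
have K12 : 12 <= K.
  by rewrite -[leLHS]mulr1 ler_wpM2l // -expR0 ler_expR mulr_ge0 // ltW.
pose b1 := Num.bound (37 / (e ^+ 3 / 48)); pose b2 := Num.bound (4 / c0).
exists (4 + b1 + b2)%N, K; split.
  by lra.
move=> k kk asat _ d alpha c aE acE _ _ y y0 glow gup.
have k4 : (4 <= k)%N by apply: leq_trans kk; rewrite -addnA leq_addr.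
have kb (x : R) (j : nat) : 0 <= x -> (Num.bound x <= j)%N -> x <= j%:R :> R.
  move=> x0 bj; apply: ltW; apply: (lt_le_trans (archi_boundP x0)).
  by rewrite ler_nat.
have ke : 37 <= k%:R * (e ^+ 3 / 48).
  rewrite -ler_pdivrMr //; apply: kb; first by rewrite divr_ge0 // ltW.
  by apply: leq_trans kk; rewrite addnAC leq_addl.
have kc0 : 4 <= k%:R * c0.
  rewrite -ler_pdivrMr //; apply: kb; first by rewrite divr_ge0 // ltW.
  by apply: leq_trans kk; rewrite leq_addl.
have k0 : (0 < k)%N by exact: leq_trans k4.
have kR : 0 < k%:R :> R by rewrite ltr0n.
have k4R : 4 <= k%:R :> R by rewrite (ler_nat R 4).
rewrite /gamma in glow gup; set s := expR (- y / 2) in glow gup.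
have s0 : 0 <= s by exact: expR_ge0.
have s1 : s <= 1 by rewrite -expR0 ler_expR mulNr oppr_le0 divr_ge0.
set tt := (1 - s) ^+ 2 in glow gup; have tt0 : 0 <= tt by exact: sqr_ge0.
have tt1 : tt <= 1 by rewrite exprn_ile1 ?subr_ge0 // gerBl.
(* the lower bound on [gamma] keeps [c] away from [0] *)
have cge : c0 / 2 <= c.
  have : 0 < c.
    rewrite ltNge; apply/negP => c_le0.
    by have := mulr_ge0 tt0 (_ : 0 <= - c); rewrite oppr_ge0 => /(_ c_le0); lra.
  by move=> cgt; have := ler_wpM2l (ltW cgt) tt1; lra.
have cgt : 0 < c by lra.
pose lam := k%:R * c * ln 2.
have dE : d%:R = lam * 2 ^+ k.-1.
  have -> : d%:R = alpha * k%:R by rewrite aE divfK // gt_eqF.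
  by rewrite acE /lam; ring.
have kd : (k <= d)%N.
  rewrite -(ler_nat R) dE; apply: le_trans (nat_le_exp2 R k0) _.
  rewrite ler_peMl ?exprn_ge0 // /lam.
  have : 2 <= k%:R * c by have := ler_wpM2l (ltW kR) cge; lra.
  by move=> kc; have := ler_pM (ler0n R 2) (_ : 0 <= 2^-1) kc l2;
     rewrite invr_ge0 ler0n => /(_ isT); lra.
have n0 : (0 < d.-1)%N.
  by rewrite -ltnS (ltn_predK (leq_trans k0 kd)) (leq_trans _ kd) // (leq_trans _ k4).
have kci : 0 <= k%:R * c by rewrite mulr_ge0 // ltW.
have lam0 : 0 <= lam by rewrite /lam mulr_ge0 //; lra.
pose g0 := lam * tt.
have g0k : 2 * g0 = k%:R * ln 2 * (2 * c * tt) by rewrite /g0 /lam; ring.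
have kl2 : 0 <= k%:R * ln (2 : R) by apply: mulr_ge0 => //; lra.
have g0low : k%:R * c0 <= 4 * g0.
  have := ler_wpM2l kl2 glow; rewrite -g0k.
  by have := ler_wpM2l (mulr_ge0 (ltW kR) (ltW hc0)) l2; lra.
have g0up : g0 * (2 / k%:R) <= C0.
  have -> : g0 * (2 / k%:R) = ln 2 * (2 * c * tt).
    have -> : g0 * (2 / k%:R) = 2 * g0 / k%:R by ring.
    by rewrite g0k; field; rewrite gt_eqF.
  have gam0 : 0 <= 2 * c * tt by apply: le_trans glow; exact: ltW.
  by apply: le_trans gup; rewrite ler_piMl.
have drift x : 0 <= x <= 1 / k%:R ^+ 2 ->
    let p := (force_poly R k).[x] in
    [/\ 0 <= p, p <= 8^-1, p <= 2 ^- k.-1 &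
      lam * (1 - 2 / k%:R) <= d.-1%:R * p /\ d.-1%:R * p <= lam].
  move=> xb p; have [plow pup p8] := force_bounds k4 xb.
  have p0 : 0 <= p.
    apply: le_trans plow; rewrite mulr_ge0 ?invr_ge0 ?exprn_ge0 //.
    by rewrite subr_ge0 invf_le1 //; lra.
  by split=> //; exact: (messages_force_bounds k0 kd dE p0 plow pup).
have k2 : 2 / k%:R <= 2^-1 :> R by rewrite ler_pdivrMr //; lra.
have [x [xb xroot] xuniq] : exists2 x, 0 <= x <= 1 / k%:R ^+ 2 /\
    (gap_poly k d.-1 s).[x] = 0 &
    forall x', 0 <= x' <= 1 / k%:R ^+ 2 -> (gap_poly k d.-1 s).[x'] = 0 -> x' = x.
  apply: gap_root e0 ke _ => // x xb; have [p0 p8 _ [nplow _]] := drift x xb.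
  rewrite mulrA; have := ler_wpM2r tt0 nplow; rewrite -/tt.
  have -> : lam * (1 - 2 / k%:R) * tt = g0 - g0 * (2 / k%:R) by rewrite /g0; ring.
  have g00 : 0 <= g0 by rewrite mulr_ge0.
  have := ler_wpM2l g00 k2; rewrite /e.
  by lra.
have x1 : 0 <= x <= 1.
  case/andP: xb => -> /= /le_trans; apply; rewrite mul1r invf_le1 ?exprn_gt0 //.
  by rewrite exprn_ege1 //; lra.
have qM : calM_bullet k (calM_of x).
  by split; [exact: calM_ofP | rewrite calM_of_spinf; case/andP: xb].
have qfix : calM_of x = SP k d y (calM_of x).
  by apply/(SP_fixedE d k4 y0 qM); rewrite calM_of_spinf.
exists (calM_of x); split.
  split=> // q' [q'M q'fix]; have [q'c q'b] := q'M.
  apply: calM_ext => //; first exact: calM_ofP.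
  rewrite calM_of_spinf; apply/esym/xuniq.
    by rewrite q'b andbT; case: q'c => + _ _; apply.
  exact/(SP_fixedE d k4 y0 q'M).
have [p0 p8 pup np] := drift x xb.
set p := (force_poly R k).[x] in p0 p8 pup np.
have Z0 := total_gt0 s0 s1 p0 p8 d.-1.
have xE : x = (tie_poly s d.-1).[p] / (total_poly s d.-1).[p].
  by move: xroot; rewrite gap_polyE -/p => /eqP; rewrite subr_eq0 => /eqP <-;
     rewrite mulfK // gt_eqF.
have pk : p <= k%:R^-1.
  by apply: le_trans pup _; rewrite lef_pV2 ?posrE ?exprn_gt0 // nat_le_exp2.
have [low up] := tie_ratio_scale s0 s1 p0 p8 k4R (ltW cgt) pk np g0up.
have scaleE : qf_scale k c y =
    expR (- g0) / Num.sqrt (Num.max (c * k%:R * s) 1).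
  rewrite /qf_scale powR2E; congr (expR _ / _).
  by rewrite /gamma -/s -/tt /g0 /lam; field.
by split; [exact: qM | rewrite calM_of_spinf scaleE xE..].
Qed.
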